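(* Let $T\subset\mathbb{R}$ be a time scale with $\sup T=\infty$, let $a\in T$ with $a>0$, and let $A(t)$, $t\in T$, be an $n\times n$ matrix-valued function on $T$ that is rd-continuous and regressive. Suppose that the integral $\int_a^\infty A(s)\,\Delta s$ is convergent (possibly only conditionally) and that the integral $$\int_a^\infty A(t)\left(\int_t^\infty A(s)\,\Delta s\right)\Delta t$$ is absolutely convergent. Then the linear system $x^\Delta=A(t)x$, $t\in T$, is of class (S).
   Context: A time scale $T$ is a nonempty closed subset of $\mathbb{R}$; $\sigma(t)=\inf\{s\in T: s>t\}$ is the forward jump operator, $\mu(t)=\sigma(t)-t$ is the graininess, $x^\Delta$ is the delta (Hilger) derivative, and $\int\cdots\Delta s$ is the delta integral on $T$. Matrices and vectors have real entries. A matrix function is rd-continuous if it is continuous at right-dense points of $T$ and has finite left-sided limits at left-dense points of $T$. The matrix function $A$ is regressive if $I+\mu(t)A(t)$ is invertible for all $t\in T$. Improper integrals: $\int_a^\infty F(t)\,\Delta t$ is convergent if $\lim_{b\to\infty,\,b\in T}\int_a^b F(t)\,\Delta t$ exists and is finite. It is absolutely convergent if $\int_a^\infty |F(t)|\,\Delta t<\infty$, where $|\cdot|$ is a matrix norm. Class (S): the system $x^\Delta=A(t)x$ is said to be of class (S) if (i) every solution $x(t)$ has a (finite) limit $x_\infty$ as $t\to\infty$, $t\in T$, and (ii) for every constant vector $x_\infty\in\mathbb{R}^n$ there is a solution $x(t)$ such that $x(t)\to x_\infty$ as $t\to\infty$. *)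

(* Defs.v *)
From HB Require Import structures.
From mathcomp Require Import all_boot all_order all_algebra.
From mathcomp Require Import all_classical all_reals all_analysis.

Set Implicit Arguments.
Unset Strict Implicit.
Unset Printing Implicit Defensive.

Import Order.TTheory GRing.Theory Num.Theory.
Import numFieldNormedType.Exports.

Local Open Scope classical_set_scope.
Local Open Scope ring_scope.

(* Functions on a time scale T are represented by total functions on R; every
   definition below inspects their values at points of T only. *)

Definition time_scale (R : realType) (T : set R) : Prop :=
  T !=set0 /\ closed T.

(* The library's inf and sup of an empty set are 0.  For sigma this can occur
   only at a maximum of T, hence never when T is unbounded above; for rho it
   occurs only at a minimum of T, which left_dense excludes. *)
Definition sigma (R : realType) (T : set R) (t : R) : R :=
  inf [set s | T s /\ t < s].

Definition rho (R : realType) (T : set R) (t : R) : R :=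
  sup [set s | T s /\ s < t].

Definition graininess (R : realType) (T : set R) (t : R) : R := sigma T t - t.

Definition right_dense (R : realType) (T : set R) (t : R) : Prop :=
  [/\ T t, exists2 s, T s & t < s & sigma T t = t].

Definition left_dense (R : realType) (T : set R) (t : R) : Prop :=
  [/\ T t, exists2 s, T s & s < t & rho T t = t].

Definition rd_continuous (R : realType) (V : normedModType R) (T : set R)
    (f : R -> V) : Prop :=
  (forall t, right_dense T t -> f @ within T (nbhs t) --> f t) /\
  (forall t, left_dense T t -> cvg (f @ within T (at_left t))).

(* l is the delta (Hilger) derivative of f at t.  On matrices, `|_| is the
   entrywise maximum norm, so this is differentiation entry by entry. *)
Definition is_delta_derive (R : realType) (V : normedModType R) (T : set R)
    (f : R -> V) (t : R) (l : V) : Prop :=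
  forall e : R, 0 < e ->
    \forall s \near within T (nbhs t),
      `|f (sigma T t) - f s - (sigma T t - s) *: l| <= e * `|sigma T t - s|.

(* The derivative is required at every point of T: a time scale that is
   unbounded above has no maximum to be left out. *)
Definition delta_antiderivative (R : realType) (V : normedModType R)
    (T : set R) (f F : R -> V) : Prop :=
  forall t, T t -> is_delta_derive T F t (f t).

(* The Cauchy delta integral F b - F a, where F is an antiderivative of f;
   rd-continuous functions have antiderivatives, and two antiderivatives
   differ by a constant on T.  The value is 0 if f has no antiderivative. *)
Definition delta_integrable (R : realType) (V : normedModType R)
    (T : set R) (f : R -> V) : Prop :=
  exists F, delta_antiderivative T f F.

Definition delta_integral (R : realType) (V : normedModType R) (T : set R)
    (f : R -> V) (a b : R) : V :=
  xget 0 [set v | exists2 F, delta_antiderivative T f F & v = F b - F a].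

(* t tends to +oo inside T. *)
Definition infty_in (R : realType) (T : set R) : set_system R :=
  within T (pinfty_nbhs R).

Definition delta_integral_oo (R : realType) (V : normedModType R) (T : set R)
    (f : R -> V) (a : R) : V :=
  lim (delta_integral T f a b @[b --> infty_in T]).

Definition delta_integral_oo_cvg (R : realType) (V : normedModType R)
    (T : set R) (f : R -> V) (a : R) : Prop :=
  delta_integrable T f /\ cvg (delta_integral T f a b @[b --> infty_in T]).

(* An arbitrary norm on the space of matrices; submultiplicativity is not
   required. *)
Definition matrix_norm (R : realType) (n : nat) (N : 'M[R]_n -> R) : Prop :=
  [/\ forall M, 0 <= N M,
      forall M, N M = 0 -> M = 0,
      forall c M, N (c *: M) = `|c| * N M
    & forall M P, N (M + P) <= N M + N P].

Definition delta_integral_oo_abs_cvg (R : realType) (n : nat)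
    (N : 'M[R]_n -> R) (T : set R) (F : R -> 'M[R]_n) (a : R) : Prop :=
  delta_integral_oo_cvg T (fun t => N (F t) : R) a.

Definition regressive (R : realType) (n : nat) (T : set R)
    (A : R -> 'M[R]_n) : Prop :=
  forall t, T t -> 1%:M + graininess T t *: A t \in unitmx.

Definition delta_solution (R : realType) (n : nat) (T : set R)
    (A : R -> 'M[R]_n) (x : R -> 'cV[R]_n) : Prop :=
  forall t, T t -> is_delta_derive T x t (A t *m x t).

Definition class_S (R : realType) (n : nat) (T : set R)
    (A : R -> 'M[R]_n) : Prop :=
  (forall x, delta_solution T A x -> cvg (x @ infty_in T)) /\
  (forall xoo : 'cV[R]_n,
     exists2 x, delta_solution T A x & x @ infty_in T --> xoo).

(* Main.v *)
Require Import Defs.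
From HB Require Import structures.
From mathcomp Require Import all_boot all_order all_algebra.
From mathcomp Require Import all_classical all_reals all_analysis.
From mathcomp Require Import ring lra.

Set Implicit Arguments.
Unset Strict Implicit.
Unset Printing Implicit Defensive.

Import Order.TTheory GRing.Theory Num.Theory.
Import numFieldNormedType.Exports.

Local Open Scope classical_set_scope.
Local Open Scope ring_scope.

(** Write [B t] for the integral of [A] from [t] to infinity.  It tends to 0 and
    its delta derivative is [- A], so for large [t] the matrix [1 - B t] is
    invertible, with an inverse of norm at most 2.  If x solves the system and
    [x = (1 - B) y], the product rule cancels the term [A y], the only one
    whose coefficient need not be absolutely integrable, and leaves

      [y' = - (1 - B (sigma t))^-1 A B y]

    ([transformed_solution_derive]).  The product [A B] is absolutely integrable:
    with [G] an antiderivative of its norm, Gronwall's inequality on [T]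
    ([gronwall]) gives

      [|y t - y s| <= |y s| (exp (K (G t - G s)) - 1)]   for [s <= t].

    As [G] converges, y is bounded and Cauchy; and x has the same limit, because
    [B] tends to 0 ([delta_solution_cvg]).

    For the second half of class (S), apply this to a matrix solution with
    [y s = 1] for a late [s].  The estimate puts the limit of y so close to the
    identity that it is invertible, and multiplying the solution on the right by
    a suitable constant vector gives any prescribed limit
    ([delta_solution_prescribed_limit]).

    A solution has to be defined on all of [T], also before [s], and its existence
    ([fundamental_matrix_exists]) is the other substantial part of the proof.
    Forward from a point [r], Euler polygons converge to a solution with value 1
    at [r] ([exact_solution_exists]): rd-continuity makes [A] almost constant
    along finitely many steps, jumps included.  Regressivity makes the resulting
    transition matrices invertible ([transition_matrix_unit]), and their inverses
    give the solution backward in time.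

    Every passage from local to global, in Gronwall's inequality, in the
    construction of the polygons and in the invertibility of the transition
    matrices, is an instance of one induction principle on [T]
    ([time_scale_induction]). *)

(** * Matrix norms *)

Lemma mx_entry_le_norm (R : realType) m n (M : 'M[R]_(m, n)) i j :
  `|M i j| <= `|M|.
Proof.
rewrite [leRHS]/Num.Def.normr /= mx_normrE.
exact: (le_bigmax 0 (fun ij : 'I_m * 'I_n => `|M ij.1 ij.2|) (i, j)).
Qed.

Lemma mx_norm_le (R : realType) m n (M : 'M[R]_(m, n)) (c : R) :
  0 <= c -> (forall i j, `|M i j| <= c) -> `|M| <= c.
Proof.
move=> c0 Mc; rewrite [leLHS]/Num.Def.normr /= mx_normrE.
by apply/bigmax_leP; split => // -[i j] _; exact: Mc.
Qed.

Lemma norm_mulmx (R : realType) m n p (M : 'M[R]_(m, n)) (P : 'M[R]_(n, p)) :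
  `|M *m P| <= n%:R * `|M| * `|P|.
Proof.
apply: mx_norm_le => [|i j]; first by rewrite !mulr_ge0.
rewrite mxE (le_trans (ler_norm_sum _ _ _))//.
apply: (@le_trans _ _ (\sum_(k < n) `|M| * `|P|)).
  by apply: ler_sum => k _; rewrite normrM ler_pM// mx_entry_le_norm.
by rewrite sumr_const card_ord mulr_natl mulrnAl.
Qed.

Lemma norm_mx1_le1 (R : realType) n : `|1%:M : 'M[R]_n| <= 1.
Proof.
apply: mx_norm_le => // i j; rewrite mxE.
by case: eqP => _; rewrite ?mulr1n ?mulr0n ?normr1 ?normr0.
Qed.

(** A vector killed by [1%:M - M] is fixed by [M], but [M] contracts. *)
Lemma unitmx_near1 (R : realType) n (M : 'M[R]_n) :
  n%:R * `|M| < 1 -> 1%:M - M \in unitmx.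
Proof.
move=> M1; rewrite unitmxE unitfE; apply/negP => /det0P [v v0 /eqP].
rewrite mulmxBr mulmx1 subr_eq0 => /eqP vM.
have : `|v| < `|v|; last by rewrite ltxx.
rewrite {1}vM (le_lt_trans (norm_mulmx v M))// mulrAC -[ltRHS]mul1r.
by rewrite ltr_pM2r ?normr_gt0.
Qed.

(** Bounds the norm of [invmx (1%:M - M)] by 2 without mentioning the inverse:
    [P] is recovered from [(1%:M - M) *m P] up to the error [M *m P], which is
    at most half of [P]. *)
Lemma norm_le_sub_mulmx (R : realType) n m (M : 'M[R]_n) (P : 'M[R]_(n, m)) :
  n%:R * `|M| <= 2^-1 -> `|P| <= 2 * `|(1%:M - M) *m P|.
Proof.
move=> M2; rewrite mulmxBl mul1mx.
have h1 : `|M *m P| <= 2^-1 * `|P|.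
  by rewrite (le_trans (norm_mulmx _ _))// ler_wpM2r.
have := ler_normD (P - M *m P) (M *m P); rewrite subrK; lra.
Qed.

(** The nontrivial half of the equivalence of norms in finite dimension: a norm
    is Lipschitz for the maximum norm, so it attains a positive minimum on the
    compact unit sphere. *)
Lemma matrix_norm_dominates (R : realType) n (N : 'M[R]_n -> R) :
  matrix_norm N -> exists2 c, 0 <= c & forall M, `|M| <= c * N M.
Proof.
case=> N0 Neq0 NZ ND.
have N00 : N 0 = 0 by rewrite -(scale0r 0) NZ normr0 mul0r.
have NN M : N (- M) = N M by rewrite -scaleN1r NZ normrN1 mul1r.
pose K : R := \sum_i \sum_j N (delta_mx i j).
have K0 : 0 <= K by apply: sumr_ge0 => i _; apply: sumr_ge0.
have NK M : N M <= K * `|M|.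
  rewrite {1}(matrix_sum_delta M) mulr_suml.
  elim/big_ind2 : _ => [|x1 x2 y1 y2 h1 h2|i _]; first by rewrite N00.
    by rewrite (le_trans (ND _ _))// lerD.
  rewrite mulr_suml.
  elim/big_ind2 : _ => [|x1 x2 y1 y2 h1 h2|j _]; first by rewrite N00.
    by rewrite (le_trans (ND _ _))// lerD.
  by rewrite NZ mulrC ler_wpM2l// mx_entry_le_norm.
have Nlip x y : `|N x - N y| <= K * `|x - y|.
  have h1 := NK (x - y); have h2 := NK (y - x).
  have := ND (x - y) y; have := ND (y - x) x; rewrite !subrK.
  by rewrite distrC in h2; rewrite ler_norml; lra.
have nv (v : 'rV[R]_(n * n)) : `|vec_mx v| = `|v|.
  apply/eqP; rewrite eq_le; apply/andP; split; apply: mx_norm_le => // i j.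
    by rewrite mxE mx_entry_le_norm.
  rewrite ord1; case/mxvec_indexP: j => j k.
  have -> : v 0 (mxvec_index j k) = vec_mx v j k by rewrite mxE.
  exact: mx_entry_le_norm.
pose S := [set v : 'rV[R]_(n * n) | `|v| = 1].
have scaled (M : 'M[R]_n) : M != 0 -> S (`|M|^-1 *: mxvec M).
  move=> M0; rewrite /S /= normrZ normfV normr_id -nv mxvecK mulVf//.
  by rewrite normr_eq0.
(* the empty sphere is the case n = 0 *)
have [S0|/set0P S0] := eqVneq S set0.
  exists 0 => // M; rewrite mul0r.
  by have [->|/scaled] := eqVneq M 0; [rewrite normr0|rewrite S0].
have Sc : compact S.
  apply: bounded_closed_compact.
    by exists 1; split => // x x1 v /= ->; exact: ltW.
  rewrite (_ : S = (fun v => `|v|) @^-1` [set 1])//.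
  apply: closed_comp => [v _|]; first exact: norm_continuous.
  exact: closed_eq.
have Ncont : continuous (fun v : 'rV[R]_(n * n) => N (vec_mx v)).
  move=> v; have FF : Filter (nbhs v) by exact: nbhs_filter.
  apply/(@cvgrPdist_le _ _ _ (nbhs v) FF) => e e0.
  near=> w; rewrite (le_trans (Nlip _ _))// -linearB nv.
  have : `|v - w| <= e / (K + 1).
    near: w; apply: cvgr_dist_le; first exact: cvg_id.
    by rewrite divr_gt0// ltr_wpDl.
  move=> h; rewrite (le_trans (ler_wpM2l K0 h))//.
  by rewrite mulrCA ler_piMr ?(ltW e0)// ler_pdivrMr ?mul1r ?ltr_wpDl// lerDl.
have [v Sv vmin] :=
  compact_EVT_min S0 Sc (@continuous_subspaceT _ _ S _ Ncont).
rewrite inE in Sv.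
have Nv : 0 < N (vec_mx v).
  rewrite lt_neqAle eq_sym N0 andbT; apply/eqP => /Neq0 v0.
  by move: Sv; rewrite /S /= -nv v0 normr0 => /eqP; rewrite eq_sym oner_eq0.
exists (N (vec_mx v))^-1 => [|M]; first by rewrite invr_ge0.
have [->|M0] := eqVneq M 0; first by rewrite normr0 N00 mulr0.
have := vmin (`|M|^-1 *: mxvec M); rewrite inE => /(_ (scaled _ M0)).
rewrite linearZ /= mxvecK NZ normfV normr_id mulrC ler_pdivlMr ?normr_gt0//.
by rewrite mulrC ler_pdivlMl // mulrC.
Unshelve. all: by end_near. Qed.

(** * Induction on a time scale *)

Lemma near_within_dist (R : realType) (T : set R) (t : R) (P : R -> Prop) :
  (\forall s \near within T (nbhs t), P s) <->
  exists2 d : R, 0 < d & forall s, T s -> `|t - s| < d -> P s.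
Proof.
rewrite near_withinE; split.
  by move=> /nbhs_ballP[d /= d0 H]; exists d => // s Ts sd; apply: (H s sd).
move=> [d d0 H]; apply/nbhs_ballP; exists d => //= s sd Ts; exact: H.
Qed.

Definition unbounded_above (R : realType) (T : set R) :=
  forall x : R, exists2 t, T t & x < t.

(** Left-density without [rho], in the form in which suprema produce it. *)
Definition left_limit (R : realType) (T : set R) (t : R) :=
  forall d : R, 0 < d -> exists2 s, T s & t - d < s < t.

Section time_scale_theory.
Variables (R : realType) (T : set R).
Hypotheses (Tcl : closed T) (Tub : unbounded_above T).

Lemma closed_has_inf (A : set R) : A `<=` T -> has_inf A -> T (inf A).
Proof.
move=> AT hA; apply: Tcl => B /nbhs_ballP[e /= e0 He].
have [s As sle] := inf_adherent e0 hA.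
exists s; split; first exact: AT.
apply: He; rewrite /ball /= distrC ger0_norm ?subr_ge0 ?ltrBlDl//.
exact: (inf_lbound hA.2).
Qed.

Lemma has_inf_after t : has_inf [set s | T s /\ t < s].
Proof.
split; first by have [s Ts ts] := Tub t; exists s.
by exists t => s [_ /ltW].
Qed.

Lemma sigma_ge t : t <= sigma T t.
Proof. by apply: lb_le_inf (has_inf_after t).1 _ => s [_ /ltW]. Qed.

Lemma sigma_le t s : T s -> t < s -> sigma T t <= s.
Proof. by move=> Ts ts; apply: (inf_lbound (has_inf_after t).2). Qed.

Lemma sigma_in t : T (sigma T t).
Proof. by apply: closed_has_inf (has_inf_after t) => s []. Qed.

Lemma lt_sigma_le t s : T s -> s < sigma T t -> s <= t.
Proof. by move=> Ts; apply: contraTle => /(sigma_le Ts); rewrite -leNgt. Qed.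

Lemma sigma_right_dense t : T t -> sigma T t = t -> right_dense T t.
Proof. by move=> Tt st; split => //; have [s Ts ts] := Tub t; exists s. Qed.

(** Treats right-scattered and right-dense points at once: a property that
    holds at the jump [sigma T t] and at the points close to [t] propagates to
    the right of [t]. *)
Lemma right_dense_step t (d : R) : T t -> 0 < d ->
  exists2 s, T s & t < s /\
  forall u, T u -> t < u -> u <= s ->
    u = sigma T t \/ sigma T t = t /\ u - t < d.
Proof.
move=> Tt d0; have := sigma_ge t; rewrite le_eqVlt => /orP[/eqP st|ts].
  have [s [Ts ts] sd] := inf_adherent d0 (has_inf_after t).
  exists s => //; split => // u Tu tu us; right; split => //.
  by rewrite ltrBlDl (le_lt_trans us)// {1}st.
exists (sigma T t); first exact: sigma_in.
split => // u Tu tu us; left; apply/eqP.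
by rewrite eq_le us sigma_le.
Qed.

Lemma left_limit_left_dense t : T t -> left_limit T t -> left_dense T t.
Proof.
move=> Tt lt; have [s0 Ts0 /andP[_ s0t]] := lt 1 ltr01.
split => //; first by exists s0.
have ubt : ubound [set s | T s /\ s < t] t by move=> s [_ /ltW].
apply/eqP; rewrite eq_le; apply/andP; split.
  by apply: sup_le_ub => //; exists s0.
apply/ler_addgt0Pr => e e0; have [s Ts /andP[ts st]] := lt e e0.
rewrite -lerBlDr (le_trans (ltW ts))//.
by apply: ub_le_sup; [exists t|].
Qed.

(** The substitute on [T] for connectedness of real intervals, and the only
    passage from local to global below.  With [c] the supremum of the points up
    to which [P] holds, [P c] follows either because [c] is attained or because
    it is a left limit, and the right step then leaves no point of [T] between [c]
    and [b]. *)
Lemma time_scale_induction (r b : R) (P : R -> Prop) : T r ->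
  P r ->
  (forall t, T t -> r <= t -> t < b -> P t ->
    exists2 s, T s & t < s /\
      forall u, T u -> t < u -> u <= s -> u <= b -> P u) ->
  (forall t, T t -> r < t -> t <= b -> left_limit T t ->
    (forall s, T s -> r <= s -> s < t -> P s) -> P t) ->
  forall t, T t -> r <= t -> t <= b -> P t.
Proof.
move=> Tr Pr right left t Tt rt tb.
have rb := le_trans rt tb.
pose S := [set t | [/\ T t, r <= t, t <= b &
  forall s, T s -> r <= s -> s <= t -> P s]].
have Sr : S r.
  by split => // s _ rs sr; rewrite (_ : s = r)//; apply/eqP; rewrite eq_le sr.
have Sub : ubound S b by move=> s [].
have hS : has_sup S by split; [exists r|exists b].
pose c := sup S.
have rc : r <= c by apply: ub_le_sup => //; exists b.
have cb : c <= b by apply: sup_le_ub => //; exists r.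
have adh e : 0 < e -> exists2 s, S s & c - e < s /\ s <= c.
  move=> e0; have [s Ss cs] := sup_adherent e0 hS.
  by exists s => //; split => //; apply: ub_le_sup => //; exists b.
have Tc : T c.
  apply: Tcl => B /nbhs_ballP[e /= e0 He].
  have [s [Ts _ _ _] [h1 h2]] := adh e e0.
  by exists s; split => //; apply: He; rewrite /ball /= ger0_norm; lra.
have Pltc s : T s -> r <= s -> s < c -> P s.
  move=> Ts rs sc; have [u [_ _ _ Pu] [h _]] := adh (c - s) ltac:(lra).
  by apply: Pu => //; lra.
have Pc : P c.
  have [Sc|nSc] := pselect (S c); first by case: Sc => _ _ _; apply.
  have llc : left_limit T c.
    move=> d d0; have [s Ss [h1 h2]] := adh d d0.
    exists s; first by case: Ss.
    rewrite h1 /= lt_neqAle h2 andbT; apply/eqP => sc; apply: nSc.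
    by rewrite -sc.
  apply: left => //; rewrite lt_neqAle rc andbT.
  by apply/eqP => rc'; apply: nSc; rewrite -rc'.
have Plec s : T s -> r <= s -> s <= c -> P s.
  by move=> Ts rs; rewrite le_eqVlt => /orP[/eqP->//|]; exact: Pltc.
have [tc|ct] := leP t c; first exact: Plec.
have cltb : c < b := lt_le_trans ct tb.
have [s Ts [cs Ps]] := right c Tc rc cltb Pc.
have St' : forall v, T v -> c < v -> v <= s -> v <= b -> S v.
  move=> v Tv cv vs vb; split => //; first by rewrite (le_trans rc)// ltW.
  move=> u Tu ru uv; have [uc|cu] := leP u c; first exact: Plec.
  by apply: Ps => //; lra.
have [ts|st] := leP t s.
  have := St' t Tt ct ts tb => -[_ _ _]; apply => //.
have := ub_le_sup (ex_intro _ b Sub) (St' s Ts cs (lexx _) _).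
by rewrite -/c; lra.
Qed.

End time_scale_theory.

(** * Delta derivatives and Gronwall's inequality *)

Section delta_derivative.
Variables (R : realType) (T : set R).
Hypotheses (Tcl : closed T) (Tub : unbounded_above T).
Variable V : normedModType R.
Implicit Types f : R -> V.

(** If [t] is right-scattered, [s] is the next point and the definition is used at
    [t] itself; if [t] is right-dense, [sigma T t = t] and this is the usual
    differentiability estimate. *)
Lemma delta_derive_increment f t l (e : R) : T t -> is_delta_derive T f t l ->
  0 < e -> exists2 s, T s & t < s /\
    forall u, T u -> t < u -> u <= s ->
      `|f u - f t - (u - t) *: l| <= e * (u - t).
Proof.
move=> Tt fl e0; have /near_within_dist[d d0 H] := fl e e0.
have [s Ts [ts Hs]] := right_dense_step Tcl Tub Tt d0.
exists s => //; split => // u Tu tu us.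
have [->|[st ud]] := Hs u Tu tu us.
  have := H t Tt; rewrite subrr normr0 => /(_ d0).
  by rewrite (ger0_norm (x := sigma T t - t)) // subr_ge0 sigma_ge.
have := H u Tu; rewrite st (distrC t u) (ger0_norm (x := u - t)); last by lra.
by move=> /(_ ud); rewrite -normrN opprD opprB opprK -[- (_ *: _)]scaleNr opprB.
Qed.

(** The definition compares [f s] with [f (sigma T t)]; using it at [s] and at
    [t] itself and subtracting eliminates the jump. *)
Lemma delta_derive_continuous f t l : T t -> is_delta_derive T f t l ->
  f @ within T (nbhs t) --> f t.
Proof.
move=> Tt fl; apply/cvgrPdist_le => e e0; apply/near_within_dist.
set m := sigma T t - t; have m0 : 0 <= m by rewrite subr_ge0 sigma_ge.
have e'0 : 0 < e / 2 / (2 * m + 1) by rewrite !divr_gt0//; lra.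
have /near_within_dist[d d0 H] := fl _ e'0.
exists (Num.min d (Num.min 1 (e / 2 / (`|l| + 1)))).
  by rewrite !lt_min d0 ltr01 !divr_gt0// ltr_wpDl.
move=> s Ts; rewrite !lt_min => /and3P[sd s1 sl].
have h1 := H t Tt; rewrite subrr normr0 in h1; have {}h1 := h1 d0.
have {H}h2 := H s Ts sd.
rewrite -/m in h1; rewrite (ger0_norm m0) in h1.
have ms : `|sigma T t - s| <= m + 1.
  rewrite (_ : sigma T t - s = m + (t - s)); last by rewrite /m; ring.
  by rewrite (le_trans (ler_normD _ _))// (ger0_norm m0) lerD2l ltW.
have h3 : `|(t - s) *: l| <= e / 2.
  rewrite normrZ; move: sl; rewrite ltr_pdivlMr ?ltr_wpDl// => /ltW; apply: le_trans.
  by rewrite ler_wpM2l// lerDl.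
have e1 : e / 2 / (2 * m + 1) * `|sigma T t - s| + e / 2 / (2 * m + 1) * m <= e / 2.
  rewrite -mulrDr mulrAC ler_pdivrMr; last by lra.
  by rewrite ler_pM2l ?divr_gt0//; lra.
rewrite (_ : f t - f s = (f (sigma T t) - f s - (sigma T t - s) *: l)
   - (f (sigma T t) - f t - m *: l) + (t - s) *: l).
  rewrite (le_trans (ler_normD _ _))// (le_trans (lerD (ler_normB _ _) h3))//.
  by move: h1 h2 e1; rewrite -/m; lra.
rewrite (_ : (t - s) *: l = (sigma T t - s) *: l - m *: l).
  by rewrite addrAC addrA subrK opprB addrA subrK opprB addrC addrA subrK.
by rewrite -scalerBl; congr (_ *: _); rewrite /m; ring.
Qed.


End delta_derivative.

Lemma expR_small (R : realType) (Y K e : R) : 0 < e ->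
  exists2 d, 0 < d & forall h, `|h| < d -> Y * (expR (K * h) - 1) < e.
Proof.
move=> e0.
have c : (fun h => Y * (expR (K * h) - 1)) @ (0 : R) --> Y * (expR (K * 0) - 1).
  apply: cvgMr; apply: cvgB; last exact: cvg_cst.
  apply: (continuous_cvg _ (@continuous_expR R _)).
  by apply: cvgMr; exact: cvg_id.
rewrite mulr0 expR0 subrr mulr0 in c.
have : \forall h \near (0 : R), Y * (expR (K * h) - 1) < e.
  exact: (cvgr_lt _ c).
move=> /nbhs_ballP[d /= d0 H]; exists d => // h hd.
by apply: H; rewrite /ball /= sub0r normrN.
Qed.

Section gronwall.
Variables (R : realType) (T : set R).
Hypotheses (Tcl : closed T) (Tub : unbounded_above T).
Variable V : normedModType R.
Variables (z z' : R -> V) (h g : R -> R) (k s t : R).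
Hypotheses (Ts : T s) (Tt : T t) (st : s <= t) (k0 : 0 <= k) (zs0 : z s = 0).
Hypothesis zz' : forall u, T u -> s <= u -> u <= t -> is_delta_derive T z u (z' u).
Hypothesis hg : forall u, T u -> s <= u -> u <= t -> is_delta_derive T h u (g u).
Hypothesis g0 : forall u, T u -> s <= u -> u <= t -> 0 <= g u.
Hypothesis z'g : forall u, T u -> s <= u -> u <= t -> `|z' u| <= g u * (`|z u| + k).

(** By induction on [T].  The right step is the inequality
    [expR a >= 1 + a]: it gives the comparison function an increment of at least
    [(k + eta) * E u * (h v - h u + eta * (v - u))], and the positive [eta] pays
    for the errors made by replacing increments of [z] and [h] by derivatives. *)
Lemma gronwall_slack (eta : R) : 0 < eta ->
  `|z t| <= (k + eta) * (expR (h t - h s + eta * (t - s)) - 1).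
Proof.
move=> eta0.
pose E u := expR (h u - h s + eta * (u - s)).
suff : `|z t| <= (k + eta) * (E t - 1) by [].
have E0 u : 0 < E u by exact: expR_gt0.
have keta : 0 < k + eta by exact: ltr_wpDl.
apply: (time_scale_induction Tcl (r := s) (b := t)
  (P := fun u => `|z u| <= (k + eta) * (E u - 1))) => //.
- by rewrite zs0 normr0 /E !subrr mulr0 addr0 expR0 subrr mulr0.
- move=> u Tu su ltut Pu; have ut := ltW ltut.
  (* small enough for both e <= eta / 2 and e <= (k + eta) * (eta - e) *)
  pose e := Num.min (eta / 2) ((k + eta) * (eta / 2)).
  have e0 : 0 < e by rewrite lt_min !mulr_gt0.
  have [v1 Tv1 [uv1 H1]] := delta_derive_increment Tcl Tub Tu (zz' Tu su ut) e0.
  have [v2 Tv2 [uv2 H2]] := delta_derive_increment Tcl Tub Tu (hg Tu su ut) e0.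
  exists (Num.min v1 v2); first by case: leP.
  rewrite lt_min uv1 uv2; split => // v Tv uv; rewrite le_min => /andP[v1v v2v] _.
  have {}H1 := H1 v Tv uv v1v; have {}H2 := H2 v Tv uv v2v.
  have uv0 : 0 <= v - u by rewrite subr_ge0 ltW.
  have zv : `|z v| <= `|z u| + (v - u) * (g u * (`|z u| + k)) + e * (v - u).
    rewrite -[z v](subrK (z u)) -[z v - z u](subrK ((v - u) *: z' u)).
    rewrite (le_trans (ler_normD _ _))// (le_trans (lerD (ler_normD _ _) (lexx _)))//.
    have h3 : `|(v - u) *: z' u| <= (v - u) * (g u * (`|z u| + k)).
      rewrite normrZ ger0_norm // .
      by rewrite ler_wpM2l //  z'g.
    lra.
  have hv : (v - u) * (g u - e) <= h v - h u.
    move: H2; rewrite ler_norml => /andP[+ _]; rewrite /GRing.scale /=; lra.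
  have Ev : E u * (1 + (v - u) * (g u - e + eta)) <= E v.
    rewrite /E (_ : h v - h s + _ = (h u - h s + eta * (u - s)) +
       (h v - h u + eta * (v - u))); last by ring.
    rewrite [leRHS]expRD ler_wpM2l ?expR_ge0//.
    by apply: le_trans (expR_ge1Dx _); rewrite lerD2l; lra.
  have gu0 := g0 Tu su ut.
  have {zv} : `|z v| <= `|z u| + (v - u) * (g u * ((k + eta) * E u) + e).
    have h5 : (v - u) * (g u * (`|z u| + k)) <= (v - u) * (g u * ((k + eta) * E u)).
      by rewrite ler_wpM2l //  ler_wpM2l//; lra.
    lra.
  have e1 : e <= eta / 2 by rewrite ge_min lexx.
  have e2 : e <= (k + eta) * (eta / 2) by rewrite ge_min lexx orbT.
  have E1 : 1 <= E u by have := le_trans (normr_ge0 _) Pu; rewrite pmulr_rge0// subr_ge0.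
  have e3 : e <= (k + eta) * E u * (eta - e).
    apply: (le_trans e2); rewrite -mulrA ler_pM2l//.
    by rewrite -[leLHS]mul1r ler_pM//; lra.
  have e4 : (v - u) * e <= (v - u) * ((k + eta) * E u * (eta - e)).
    exact: ler_wpM2l.
  have := ler_wpM2l (ltW keta) Ev.
  rewrite !mulrDr; lra.
- move=> u Tu su ut llu Pu.
  rewrite leNgt; apply/negP => Pn.
  have zc := delta_derive_continuous Tub Tu (zz' Tu (ltW su) ut).
  have hc := delta_derive_continuous Tub Tu (hg Tu (ltW su) ut).
  have psic : (fun v => `|z v| - (k + eta) * (E v - 1)) @ within T (nbhs u) -->
    `|z u| - (k + eta) * (E u - 1).
    apply: cvgB; first exact: cvg_norm.
    apply: cvgMr; apply: cvgB; last exact: cvg_cst.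
    apply: (continuous_cvg _ (@continuous_expR R _)).
    apply: cvgD; first by apply: cvgB => //; exact: cvg_cst.
    apply: cvgMr; apply: cvgB; last exact: cvg_cst.
    exact: cvg_within.
  have /near_within_dist[d d0 H] := cvgr_gt _ psic 0 ltac:(lra).
  have [v Tv /andP[uv vu]] := llu (Num.min d (u - s)) ltac:(by rewrite lt_min d0 subr_gt0).
  have := H v Tv; rewrite ger0_norm; last by rewrite subr_ge0 ltW.
  have := Pu v Tv.
  have : Num.min d (u - s) <= d by rewrite ge_min lexx.
  have : Num.min d (u - s) <= u - s by rewrite ge_min lexx orbT.
  move=> m1 m2 h1 h2; have := h1 ltac:(lra) vu; have := h2 ltac:(lra); lra.
Qed.

(** Gronwall's inequality in the form that serves everywhere below.  The growth
    rate is given through its antiderivative [h], so that no integral of [g] is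
    needed; for [z = x - x s] and [k] the norm of [x s] it bounds how far a
    solution moves, for [k = 0] it is a uniqueness statement, and for [g = 0] it
    says that a function with zero derivative is constant. *)
Lemma gronwall : `|z t| <= k * (expR (h t - h s) - 1).
Proof.
have c : (fun eta => (k + eta) * (expR (h t - h s + eta * (t - s)) - 1)) @ 0^'+ -->
   (k + 0) * (expR (h t - h s + 0 * (t - s)) - 1).
  apply: cvg_at_right_filter.
  apply: cvgM; first by apply: cvgD; [exact: cvg_cst|exact: cvg_id].
  apply: cvgB; last exact: cvg_cst.
  apply: (continuous_cvg _ (@continuous_expR R _)).
  apply: cvgD; first exact: cvg_cst.
  by apply: cvgMl; exact: cvg_id.
rewrite addr0 mul0r addr0 in c.
rewrite -(cvg_lim (@Rhausdorff R) c).
apply: limr_ge; first by apply/cvg_ex; eexists; exact: c.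
near=> eta; apply: gronwall_slack => //.
Unshelve. all: by end_near. Qed.
End gronwall.

(** * Fine steps for rd-continuous matrix functions *)

Section existence.
Variables (R : realType) (T : set R).
Hypotheses (Tcl : closed T) (Tub : unbounded_above T).
Variables (n : nat) (A : R -> 'M[R]_n).
Hypothesis (Ard : rd_continuous T A).

(** Only points before [v] matter, so a jump from [u] to [sigma T u] is a fine
    step however long it is. *)
Definition fine_step (eta u v : R) := forall w, T w -> u <= w -> w < v ->
  `|A w - A u| <= eta /\ w - u <= eta.

Lemma fine_step_right (eta t : R) : 0 < eta -> T t ->
  exists2 s, T s & t < s /\
    forall u, T u -> t < u -> u <= s -> fine_step eta t u.
Proof.
move=> eta0 Tt.
have [d d0 Hd] : exists2 d, 0 < d & sigma T t = t ->
    forall w, T w -> `|t - w| < d -> `|A w - A t| <= eta.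
  have [/(sigma_right_dense Tub Tt) td|nst] := pselect (sigma T t = t); last by exists 1 => // /nst.
  have /cvgrPdist_le/(_ _ eta0)/near_within_dist[d d0 H] := Ard.1 t td.
  by exists d => // _ w Tw wd; rewrite distrC; exact: H.
have [s Ts [ts H]] := @right_dense_step _ _ Tcl Tub t (Num.min d eta) Tt ltac:(by rewrite lt_min d0).
exists s => //; split => // u Tu tu us w Tw tw wu.
have [ut|[st]] := H u Tu tu us.
  have -> : w = t.
    by apply/eqP; rewrite eq_le tw andbT (lt_sigma_le Tub Tw)// -ut.
  by rewrite !subrr normr0 ltW.
rewrite lt_min => /andP[ud ue]; split; last by lra.
by apply: Hd => //; rewrite distrC ger0_norm; lra.
Qed.

Lemma fine_step_left (eta c : R) : 0 < eta -> T c -> left_limit T c ->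
  exists2 d, 0 < d & forall s, T s -> c - d < s -> fine_step eta s c.
Proof.
move=> eta0 Tc lc.
have /cvg_ex[/= l] := Ard.2 c (left_limit_left_dense Tc lc).
move=> /cvgrPdist_le/(_ (eta / 2) ltac:(lra)).
rewrite near_withinE /at_left near_withinE => /nbhs_ballP[d /= d0 H].
have {}H w : T w -> c - d < w -> w < c -> `|l - A w| <= eta / 2.
  move=> Tw h1 h2; apply: (H w) => //.
  by rewrite /ball /= ger0_norm; lra.
exists (Num.min d eta); first by rewrite lt_min d0.
move=> s Ts sd w Tw sw wc.
have m1 : Num.min d eta <= d by rewrite ge_min lexx.
have m2 : Num.min d eta <= eta by rewrite ge_min lexx orbT.
split; last by lra.
have := ler_distD l (A w) (A s); rewrite (distrC (A w) l).
have := H w Tw ltac:(lra) wc.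
have := H s Ts ltac:(lra) ltac:(lra).
lra.
Qed.

(** Stands for the partition of an interval into finitely many fine steps, the
    analogue for [T] of approximating a regulated function by step functions:
    right steps come from continuity at right-dense points, left steps from the
    existence of left limits. *)
Lemma fine_step_induction (eta r b : R) (P : R -> Prop) : 0 < eta -> T r ->
  P r ->
  (forall u v, T u -> T v -> r <= u -> u < v -> v <= b -> fine_step eta u v ->
    P u -> P v) ->
  forall t, T t -> r <= t -> t <= b -> P t.
Proof.
move=> eta0 Tr Pr step; apply: (time_scale_induction Tcl) => //.
  move=> t Tt rt tb Pt; have [s Ts [ts H]] := fine_step_right eta0 Tt.
  exists s => //; split => // u Tu tu us ub.
  by apply: (step t u) => //; exact: H.
move=> t Tt rt tb lt Pt; have [d d0 H] := fine_step_left eta0 Tt lt.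
have [s Ts /andP[ds st]] := lt (Num.min d (t - r)) ltac:(by rewrite lt_min d0 subr_gt0).
have m1 : Num.min d (t - r) <= d by rewrite ge_min lexx.
have m2 : Num.min d (t - r) <= t - r by rewrite ge_min lexx orbT.
by apply: (step s t) => //; [lra|apply: H => //; lra|apply: Pt => //; lra].
Qed.

Lemma rd_continuous_bounded (r b : R) : T r ->
  exists2 M, 0 <= M & forall t, T t -> r <= t -> t <= b -> `|A t| <= M.
Proof.
move=> Tr; have [br|rb] := ltP b r.
  by exists 0 => // t _ rt tb; lra.
(* the induction ends at a point of T, so b is first replaced by the last
   point of T before it *)
suff H t : T t -> r <= t -> t <= b ->
    exists2 M, 0 <= M & forall s, T s -> r <= s -> s <= t -> `|A s| <= M.
  have hS : has_sup [set t | T t /\ t <= b].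
    by split; [exists r|exists b => t []].
  pose c := sup [set t | T t /\ t <= b].
  have cb : c <= b by apply: sup_le_ub; [exists r|move=> t []].
  have le_c t : T t -> t <= b -> t <= c.
    by move=> Tt tb; apply: ub_le_sup; [exists b => s []|].
  have Tc : T c.
    apply: Tcl => B /nbhs_ballP[e /= e0 He].
    have [s [Ts sb] cs] := sup_adherent e0 hS.
    exists s; split => //; apply: He; rewrite /ball /=.
    by have := le_c s Ts sb; rewrite -/c in cs => sc; rewrite ger0_norm; lra.
  have [M M0 HM] := H c Tc (le_c r Tr rb) cb.
  by exists M => // t Tt rt tb; apply: HM => //; exact: le_c.
apply: (fine_step_induction (eta := 1)
  (P := fun t => exists2 M, 0 <= M & forall s, T s -> r <= s -> s <= t -> `|A s| <= M)) => //.
  exists `|A r| => // s Ts rs sr.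
  by rewrite (_ : s = r)//; apply/eqP; rewrite eq_le sr.
move=> u v Tu Tv ru uv vb fuv [M M0 HM].
exists (Num.max (M + 1) `|A v|); first by rewrite le_max; apply/orP; left; lra.
move=> s Ts rs sv; rewrite le_max; apply/orP.
have [su|us] := leP s u; first by left; have := HM s Ts rs su; lra.
move: sv; rewrite le_eqVlt => /orP[/eqP->|sv]; first by right.
left; have := HM u Tu ru (lexx _).
have [+ _] := fuv s Ts (ltW us) sv.
have := ler_distD (A u) (A s) 0; rewrite !subr0; lra.
Qed.

End existence.

(** * Approximate solutions *)

(** The mean value inequality, with a defect [eps], for a function whose
    derivative at [w] is [A w *m X w].  Testing against all constants [L] encodes
    the integral equation without an integral; the condition is additive over
    adjacent intervals and passes to uniform limits. *)
Definition approx_solution (R : realType) (T : set R) (n : nat)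
    (A : R -> 'M[R]_n) (eps r b : R) (X : R -> 'M[R]_n) :=
  forall u v, T u -> T v -> r <= u -> u <= v -> v <= b ->
  forall L eta, (forall w, T w -> u <= w -> w < v -> `|A w *m X w - L| <= eta) ->
    `|X v - X u - (v - u) *: L| <= (v - u) * (eta + eps).

Section approximate_solutions.
Variables (R : realType) (T : set R).
Hypotheses (Tcl : closed T) (Tub : unbounded_above T).
Variables (n : nat) (A : R -> 'M[R]_n).
Hypothesis (Ard : rd_continuous T A).
Implicit Types X Y : R -> 'M[R]_n.

Lemma approx_solution_eq (eps r b : R) X Y :
  (forall s, T s -> r <= s -> s <= b -> X s = Y s) ->
  approx_solution T A eps r b X -> approx_solution T A eps r b Y.
Proof.
move=> XY aX u v Tu Tv ru uv vb L eta HY.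
rewrite -!XY//; try lra.
apply: aX => // w Tw uw wv; rewrite XY//; try lra.
exact: HY.
Qed.

Lemma approx_solution_cat (eps r c b : R) X : T c ->
  approx_solution T A eps r c X -> approx_solution T A eps c b X ->
  approx_solution T A eps r b X.
Proof.
move=> Tc aX bX u v Tu Tv ru uv vb L eta HX.
have [vc|cv] := leP v c; first exact: aX.
have [cu|uc] := leP c u; first exact: bX.
have h1 : `|X c - X u - (c - u) *: L| <= (c - u) * (eta + eps).
  by apply: aX => //; [exact: ltW|move=> w Tw uw wc; apply: HX => //; lra].
have h2 : `|X v - X c - (v - c) *: L| <= (v - c) * (eta + eps).
  by apply: bX => //; [exact: ltW|move=> w Tw cw wv; apply: HX => //; lra].
have -> : X v - X u - (v - u) *: L =
    (X v - X c - (v - c) *: L) + (X c - X u - (c - u) *: L).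
  by apply/matrixP => i j; rewrite !mxE; ring.
rewrite (le_trans (ler_normD _ _))// (le_trans (lerD h2 h1))//; lra.
Qed.

Variables (r b M : R).
Hypotheses (Tr : T r) (M0 : 0 <= M).
Hypothesis (AM : forall t, T t -> r <= t -> t <= b -> n%:R * `|A t| <= M).

Lemma norm_mulmx_le t (Y : 'M[R]_n) : T t -> r <= t -> t <= b ->
  `|A t *m Y| <= M * `|Y|.
Proof.
by move=> Tt rt tb; rewrite (le_trans (norm_mulmx _ _))// ler_wpM2r// AM.
Qed.

Lemma approx_solution_lipschitz (eps K : R) X u v :
  approx_solution T A eps r b X ->
  (forall t, T t -> r <= t -> t <= b -> `|X t| <= K) ->
  T u -> T v -> r <= u -> u <= v -> v <= b ->
  `|X v - X u| <= (v - u) * (M * K + eps).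
Proof.
move=> aX XK Tu Tv ru uv vb.
have := aX u v Tu Tv ru uv vb 0 (M * K); rewrite scaler0 subr0; apply.
move=> w Tw uw wv; rewrite subr0 (le_trans (norm_mulmx_le _ _ _ _))//; try lra.
by rewrite ler_wpM2l// XK//; lra.
Qed.

Lemma norm_mulmx_increment u w (Y Z : 'M[R]_n) : T u -> r <= u -> u <= b ->
  `|A w *m Y - A u *m Z| <= n%:R * `|A w - A u| * `|Y| + M * `|Y - Z|.
Proof.
move=> Tu ru ub.
have -> : A w *m Y - A u *m Z = (A w - A u) *m Y + A u *m (Y - Z).
  by rewrite mulmxBl mulmxBr addrA subrK.
by rewrite (le_trans (ler_normD _ _))// lerD ?norm_mulmx ?norm_mulmx_le.
Qed.

(** One step of Euler's method: along a fine step the slope [A s *m X s] stays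
    within [eps] of the constant slope [A u *m X u]. *)
Lemma approx_solution_step (eps eta K u v : R) X :
  (0 <= K) ->
  eta * (n%:R * K + M * (M * K)) <= eps ->
  T u -> T v -> r <= u -> u < v -> v <= b -> fine_step T A eta u v ->
  (forall s, T s -> u <= s -> s <= v ->
     `|X s| <= K /\ X s = X u + (s - u) *: (A u *m X u)) ->
  approx_solution T A eps u v X.
Proof.
move=> K0 etaK Tu Tv ru uv vb fuv HX u' v' Tu' Tv' uu' u'v' v'v L e HL.
move: u'v'; rewrite le_eqVlt => /orP[/eqP->|u'v'].
  by rewrite !subrr scale0r subr0 normr0 mul0r.
rewrite (HX v' Tv' _ v'v).2 ?(HX u' Tu' _ _).2; try lra.
have -> : X u + (v' - u) *: (A u *m X u) - (X u + (u' - u) *: (A u *m X u))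
   - (v' - u') *: L = (v' - u') *: (A u *m X u - L).
  by rewrite -[RHS]/( _ *: (_ - _)); apply/matrixP => i j; rewrite !mxE; ring.
have vu0 : 0 <= v' - u' by rewrite subr_ge0 ltW.
rewrite normrZ ger0_norm// ler_wpM2l//.
have hu' := HL u' Tu' (lexx _) u'v'.
rewrite -[A u *m X u](subrK (A u' *m X u')) -addrA.
rewrite (le_trans (ler_normD _ _))// (addrC e) lerD//.
rewrite distrC (le_trans (norm_mulmx_increment _ _ _ _ _ _))//; try lra.
have [h1 h2] := fuv u' Tu' uu' (lt_le_trans u'v' v'v).
have [h3 h4] := HX u' Tu' uu' (le_trans (ltW u'v') v'v).
have h5 : `|X u' - X u| <= eta * (M * K).
  rewrite h4 addrC addKr normrZ ger0_norm ?subr_ge0//.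
  apply: ler_pM => //; first by rewrite subr_ge0.
  rewrite (le_trans (norm_mulmx_le _ _ _ _))//; try lra.
  by rewrite ler_wpM2l// (HX u Tu _ _).1//; lra.
have h6 : n%:R * `|A u' - A u| * `|X u'| <= n%:R * eta * K.
  by rewrite ler_pM// ?mulr_ge0// ler_wpM2l.
have h7 : M * `|X u' - X u| <= M * (eta * (M * K)) by rewrite ler_wpM2l.
move: etaK; lra.
Qed.

(** Euler polygons.  The exponential bound is carried through the construction
    because the fineness of the steps must be chosen in advance, from a bound on
    the norm of the polygon. *)
Lemma approx_solution_exists (eps : R) : 0 < eps -> forall c, T c -> r <= c -> c <= b ->
  exists X, [/\ X r = 1%:M, approx_solution T A eps r c X &
    forall t, T t -> r <= t -> t <= c -> `|X t| <= expR (M * (t - r))].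
Proof.
move=> eps0.
pose K := expR (M * (b - r)).
have K0 : 0 < K by exact: expR_gt0.
have n0 : 0 <= n%:R :> R by [].
have nK0 : 0 <= n%:R * K + M * (M * K) by rewrite addr_ge0 ?mulr_ge0 ?(ltW K0).
pose eta := eps / (n%:R * K + M * (M * K) + 1).
have eta0 : 0 < eta by rewrite divr_gt0// ltr_wpDl.
have etaK : eta * (n%:R * K + M * (M * K)) <= eps.
  by rewrite /eta mulrAC ler_pdivrMr ?ltr_wpDl// ler_pM2l// lerDl.
apply: (fine_step_induction Tcl Tub Ard (eta := eta)
  (P := fun c => exists X, [/\ X r = 1%:M, approx_solution T A eps r c X &
    forall t, T t -> r <= t -> t <= c -> `|X t| <= expR (M * (t - r))])) => //.
  exists (fun=> 1%:M); split => //.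
    move=> u v _ _ ru uv vr L e _.
    have -> : v = u by apply/eqP; rewrite eq_le uv andbT; lra.
    by rewrite !subrr scale0r subr0 normr0 mul0r.
  move=> t _ rt tr; rewrite (le_trans (norm_mx1_le1 _ _))//.
  by rewrite -expR0 ler_expR mulr_ge0// subr_ge0.
move=> u v Tu Tv ru uv vb fuv [X [Xr aX XM]].
pose Y s := if s <= u then X s else X u + (s - u) *: (A u *m X u).
have Yle s : s <= u -> Y s = X s by rewrite /Y => ->.
have Yge s : u <= s -> Y s = Y u + (s - u) *: (A u *m Y u).
  rewrite le_eqVlt => /orP[/eqP->|us]; first by rewrite subrr scale0r addr0.
  by rewrite (Yle u)// /Y leNgt us.
have YM t : T t -> r <= t -> t <= v -> `|Y t| <= expR (M * (t - r)).
  move=> Tt rt tv; have [tu|ut] := leP t u; first by rewrite Yle// XM.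
  rewrite Yge ?(ltW ut)// Yle//.
  have h1 := XM u Tu ru (lexx _).
  have h2 : `|(t - u) *: (A u *m X u)| <= (t - u) * (M * expR (M * (u - r))).
    have tu0 : 0 <= t - u by rewrite subr_ge0 ltW.
    rewrite normrZ ger0_norm// ler_wpM2l//.
    rewrite (le_trans (norm_mulmx_le _ _ _ _))//; try lra.
    by rewrite ler_wpM2l.
  have -> : M * (t - r) = M * (u - r) + M * (t - u) by ring.
  rewrite expRD (le_trans (ler_normD _ _))// (le_trans (lerD h1 h2))//.
  have := ler_wpM2l (expR_ge0 (M * (u - r))) (expR_ge1Dx (M * (t - u))).
  lra.
exists Y; split => //; first by rewrite Yle.
apply: (approx_solution_cat (c := u)) => //.
  by apply: approx_solution_eq aX => s _ _ su; rewrite Yle.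
apply: (approx_solution_step (K := K) (eta := eta)) => //; first exact: ltW.
move=> s Ts us sv; split; last exact: Yge.
rewrite (le_trans (YM _ _ _ _))//; first lra.
rewrite ler_expR ler_wpM2l//; lra.
Qed.

(** The discrete Gronwall argument: across a fine step the distance between two
    approximate solutions is multiplied by at most [1 + M * (v - u)] and
    increased by at most [4 * eps * (v - u)], twice the defect [eps] plus twice
    the error [eps] made by freezing the slope. *)
Lemma approx_solution_dist (eps K : R) X Y : 0 < eps ->
  approx_solution T A eps r b X -> approx_solution T A eps r b Y ->
  (forall t, T t -> r <= t -> t <= b -> `|X t| <= K) ->
  (forall t, T t -> r <= t -> t <= b -> `|Y t| <= K) ->
  X r = Y r ->
  forall t, T t -> r <= t -> t <= b ->
    `|X t - Y t| <= 4 * eps * expR ((M + 1) * (t - r)).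
Proof.
move=> eps0 aX aY XK YK XY t Tt rt tb.
have K0 : 0 <= K by rewrite (le_trans _ (XK r Tr _ _))//; lra.
pose Q := n%:R * K + M * (M * K + eps).
have Q0 : 0 <= Q by rewrite addr_ge0 ?mulr_ge0 ?addr_ge0 ?mulr_ge0// ltW.
pose eta := eps / (Q + 1).
have eta0 : 0 < eta by rewrite divr_gt0// ltr_wpDl.
have etaQ : eta * Q <= eps.
  by rewrite /eta mulrAC ler_pdivrMr ?ltr_wpDl// ler_pM2l// lerDl.
have step Z u v : approx_solution T A eps r b Z ->
  (forall t, T t -> r <= t -> t <= b -> `|Z t| <= K) ->
  T u -> T v -> r <= u -> u < v -> v <= b -> fine_step T A eta u v ->
  `|Z v - Z u - (v - u) *: (A u *m Z u)| <= (v - u) * (eps + eps).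
  move=> aZ ZK Tu Tv ru uv vb fuv; apply: (aZ) => //; first exact: ltW.
  move=> w Tw uw wv; have [h1 h2] := fuv w Tw uw wv.
  rewrite (le_trans (norm_mulmx_increment _ _ _ _ _ _))//; try lra.
  have h3 := approx_solution_lipschitz aZ ZK Tu Tw ru uw ltac:(lra).
  have h4 : n%:R * `|A w - A u| * `|Z w| <= n%:R * eta * K.
    by rewrite ler_pM ?mulr_ge0// ?ler_wpM2l// ZK//; lra.
  have h5 : M * `|Z w - Z u| <= M * (eta * (M * K + eps)).
    rewrite ler_wpM2l// (le_trans h3)// ler_wpM2r//.
    by rewrite addr_ge0 ?mulr_ge0// ltW.
  by move: etaQ; rewrite /Q; lra.
apply: (fine_step_induction Tcl Tub Ard (eta := eta)
  (P := fun t => `|X t - Y t| <= 4 * eps * expR ((M + 1) * (t - r)))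
  (r := r) (b := b)) => //.
  by rewrite XY subrr normr0 !mulr_ge0 ?expR_ge0// ltW.
move=> u v Tu Tv ru uv vb fuv Pu.
have h1 := step X u v aX XK Tu Tv ru uv vb fuv.
have h2 := step Y u v aY YK Tu Tv ru uv vb fuv.
have -> : X v - Y v = (X v - X u - (v - u) *: (A u *m X u))
  - (Y v - Y u - (v - u) *: (A u *m Y u))
  + ((X u - Y u) + (v - u) *: (A u *m (X u - Y u))).
  by rewrite mulmxBr; apply/matrixP => i j; rewrite !mxE; ring.
rewrite (le_trans (ler_normD _ _))// (le_trans (lerD (ler_normB _ _) (ler_normD _ _)))//.
have vu0 : 0 <= v - u by rewrite subr_ge0 ltW.
have h3 : `|(v - u) *: (A u *m (X u - Y u))| <= (v - u) * (M * `|X u - Y u|).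
  rewrite normrZ ger0_norm// ler_wpM2l//.
  by rewrite norm_mulmx_le//; lra.
pose E := expR ((M + 1) * (u - r)).
have E1 : 1 <= E by rewrite -expR0 ler_expR mulr_ge0 ?subr_ge0 ?addr_ge0.
have -> : (M + 1) * (v - r) = (M + 1) * (u - r) + (M + 1) * (v - u) by ring.
rewrite expRD -/E in Pu *.
have h4 : 4 * eps * E * (1 + (M + 1) * (v - u)) <=
          4 * eps * (E * expR ((M + 1) * (v - u))).
  by rewrite -mulrA ler_pM2l ?mulr_gt0// ler_pM2l ?expR_gt0// expR_ge1Dx.
have h5 : (v - u) * (M * `|X u - Y u|) <= (v - u) * (M * (4 * eps * E)).
  by rewrite !ler_wpM2l.
have h6 : (v - u) * (4 * eps) <= (v - u) * (4 * eps * E).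
  rewrite ler_wpM2l// ler_peMr//; lra.
lra.
Qed.

End approximate_solutions.

(** * Forward solutions as limits of approximate solutions *)

Section exact_solution.
Variables (R : realType) (T : set R).
Hypotheses (Tcl : closed T) (Tub : unbounded_above T).
Variables (n : nat) (A : R -> 'M[R]_n).
Hypothesis (Ard : rd_continuous T A).
Implicit Types X Y : R -> 'M[R]_n.

Lemma approx_solution_weaken (eps eps' r b b' : R) X : eps <= eps' -> b' <= b ->
  approx_solution T A eps r b X -> approx_solution T A eps' r b' X.
Proof.
move=> ee' bb' aX u v Tu Tv ru uv vb' L eta HL.
apply: (le_trans (aX u v Tu Tv ru uv (le_trans vb' bb') L eta HL)).
by rewrite ler_wpM2l ?subr_ge0// lerD2l.
Qed.

Lemma small_inverse (Q e : R) : 0 <= Q -> 0 < e -> exists k, k.+1%:R^-1 * Q <= e.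
Proof.
move=> Q0 e0; have [k] := @ltr_add_invr R 0 (e / (Q + 1)) ltac:(by rewrite divr_gt0// ltr_wpDl).
rewrite add0r => kQ; exists k.
rewrite (le_trans (ler_wpM2r Q0 (ltW kQ)))//.
by rewrite mulrAC ler_pdivrMr ?ltr_wpDl// ler_pM2l// lerDl.
Qed.

(** The limit of Euler polygons with defects [1 / (k + 1)].  The value at [t] is
    defined from polygons on the interval from [r] to [t]; as polygons on
    different intervals are close where both exist, the limit is a solution on
    every bounded interval, with no gluing over right endpoints. *)
Lemma exact_solution_exists (r : R) : T r -> exists X, X r = 1%:M /\
  forall b, T b -> r <= b -> approx_solution T A 0 r b X /\
    exists K, forall t, T t -> r <= t -> t <= b -> `|X t| <= K.
Proof.
move=> Tr.
have [M HM] : {M : R -> R & forall c, 0 <= M c /\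
    forall t, T t -> r <= t -> t <= c -> n%:R * `|A t| <= M c}.
  apply: (@choice _ _ (fun c m => 0 <= m /\
    forall t, T t -> r <= t -> t <= c -> n%:R * `|A t| <= m)) => c.
  have [M M0 HM] := rd_continuous_bounded Tcl Tub Ard c Tr.
  exists (n%:R * M); split; first by rewrite mulr_ge0.
  by move=> t Tt rt tc; rewrite ler_wpM2l// HM.
pose eps k : R := k.+1%:R^-1.
have eps0 k : 0 < eps k by rewrite invr_gt0.
have epsle j k : (k <= j)%N -> eps j <= eps k.
  by move=> kj; rewrite lef_pV2 ?posrE// ler_nat.
have [Z HZ] : {Z : R * nat -> R -> 'M[R]_n & forall ck, T ck.1 -> r <= ck.1 ->
    [/\ Z ck r = 1%:M, approx_solution T A (eps ck.2) r ck.1 (Z ck) &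
    forall t, T t -> r <= t -> t <= ck.1 -> `|Z ck t| <= expR (M ck.1 * (t - r))]}.
  apply: (@choice _ _ (fun ck Z => T ck.1 -> r <= ck.1 ->
    [/\ Z r = 1%:M, approx_solution T A (eps ck.2) r ck.1 Z &
    forall t, T t -> r <= t -> t <= ck.1 -> `|Z t| <= expR (M ck.1 * (t - r))])).
  move=> [c k] /=; have [[Tc rc]|nc] := pselect (T c /\ r <= c).
    have [X HX] := approx_solution_exists Tcl Tub Ard Tr (HM c).1 (HM c).2
      (eps0 k) Tc rc (lexx c).
    by exists X.
  by exists (fun=> 0) => Tc rc; case: nc.
pose C b : R := 4 * expR ((M b + 1) * (b - r)).
have C0 b : 0 <= C b by rewrite mulr_ge0 ?expR_ge0.
have cmp b c j k t : T b -> T c -> r <= t -> T t -> t <= c -> c <= b -> (k <= j)%N ->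
    `|Z (b, k) t - Z (c, j) t| <= eps k * C b.
  move=> Tb Tc rt Tt tc cb kj.
  have rc := le_trans rt tc; have rb := le_trans rc cb.
  have /=[X1 X2 X3] := HZ (b, k) Tb rb; have /=[Y1 Y2 Y3] := HZ (c, j) Tc rc.
  have Mexp m s : 0 <= m -> s <= b -> r <= s -> expR (m * (s - r)) <= expR (m * (b - r)).
    by move=> m0 sb rs; rewrite ler_expR ler_wpM2l// lerD2r.
  have := @approx_solution_dist _ T Tcl Tub n A Ard r c (M b) Tr (HM b).1
    (fun s Ts rs sc => (HM b).2 s Ts rs (le_trans sc cb)) (eps k)
    (Num.max (expR (M b * (b - r))) (expR (M c * (b - r)))) (Z (b, k)) (Z (c, j)) (eps0 k)
    (approx_solution_weaken (lexx _) cb X2) (approx_solution_weaken (epsle _ _ kj) (lexx _) Y2)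
    _ _ _ t Tt rt tc.
  move=> /(_ _ _ _)/le_trans; apply.
  - move=> s Ts rs sc; rewrite le_max; apply/orP; left.
    have sb := le_trans sc cb.
    by rewrite (le_trans (X3 _ _ _ _))// Mexp// (HM b).1.
  - move=> s Ts rs sc; rewrite le_max; apply/orP; right.
    have sb := le_trans sc cb.
    by rewrite (le_trans (Y3 _ _ _ _))// Mexp// (HM c).1.
  - by rewrite X1 Y1.
  rewrite /C mulrCA mulrA ler_wpM2l ?mulr_ge0 ?(ltW (eps0 k))// Mexp//.
    by rewrite addr_ge0// (HM b).1.
  exact: le_trans tc cb.
have Zcvg t : T t -> r <= t -> cvg (Z (t, k) t @[k --> \oo]).
  move=> Tt rt; apply: cauchy_cvg; apply: cauchy_exP => e e0.
  have [k kC] := @small_inverse (C t) (e / 2) (C0 t) ltac:(lra).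
  exists (Z (t, k) t); exists k => // j /= kj.
  rewrite -ball_normE /ball_ /=; apply: (le_lt_trans (cmp t t j k t Tt Tt rt Tt (lexx _) (lexx _) kj)).
  by apply: (le_lt_trans kC); lra.
pose X t := lim (Z (t, k) t @[k --> \oo]).
have XZ b k t : T b -> T t -> r <= t -> t <= b -> `|Z (b, k) t - X t| <= eps k * C b.
  move=> Tb Tt rt tb.
  have cX : `|Z (b, k) t - Z (t, j) t| @[j --> \oo] --> `|Z (b, k) t - X t|.
    by apply: cvg_norm; apply: cvgB; [exact: cvg_cst|exact: Zcvg].
  rewrite -(cvg_lim (@Rhausdorff R) cX); apply: limr_le.
    by apply/cvg_ex; eexists; exact: cX.
  by exists k => // j /= kj; exact: cmp.
exists X; split.
  apply/eqP; rewrite eq_sym -subr_eq0 -normr_le0; apply/ler_addgt0Pl => e e0.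
  have [k kC] := small_inverse (C0 r) e0.
  have [Z1 _ _] := HZ (r, k) Tr (lexx _).
  have := XZ r k r Tr Tr (lexx _) (lexx _).
  by rewrite Z1 addr0 => /le_trans; apply.
move=> b Tb rb.
split; last first.
  exists (expR (M b * (b - r)) + eps 0%N * C b) => t Tt rt tb.
  have [_ _ /(_ t Tt rt tb) /= h1] := HZ (b, 0%N) Tb rb.
  have h2 := XZ b 0%N t Tb Tt rt tb.
  have h3 : expR (M b * (t - r)) <= expR (M b * (b - r)).
    by rewrite ler_expR ler_wpM2l ?(HM b).1// lerD2r.
  rewrite -[X t](subrK (Z (b, 0%N) t)) addrC (le_trans (ler_normD _ _))//.
  by rewrite lerD// ?(le_trans h1)// distrC.
move=> u v Tu Tv ru uv vb L eta HL; rewrite addr0.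
have vu0 : 0 <= v - u by rewrite subr_ge0.
have [M0 MA] := HM b.
pose Q := 2 * C b + (v - u) * (M b * C b + 1).
have Q0 : 0 <= Q by rewrite addr_ge0 ?mulr_ge0 ?C0 ?vu0 ?addr_ge0 ?mulr_ge0 ?C0.
apply/ler_addgt0Pl => e e0.
have [k kQ] := small_inverse Q0 e0.
have [_ aZ _] := HZ (b, k) Tb rb.
have du := XZ b k u Tb Tu ru (le_trans uv vb).
have dv := XZ b k v Tb Tv (le_trans ru uv) vb.
have HZL w : T w -> u <= w -> w < v -> `|A w *m Z (b, k) w - L| <= eta + M b * (eps k * C b).
  move=> Tw uw wv.
  rewrite (_ : A w *m Z (b, k) w - L = (A w *m X w - L) + A w *m (Z (b, k) w - X w)).
    rewrite (le_trans (ler_normD _ _))// lerD ?HL//.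
    have rw := le_trans ru uw; have wb := le_trans (ltW wv) vb.
    rewrite (le_trans (norm_mulmx_le MA _ _ _ _))// ler_wpM2l//.
    exact: XZ.
  by rewrite mulmxBr [RHS]addrC addrA subrK.
have := aZ u v Tu Tv ru uv vb L _ HZL => /= hZ.
rewrite (_ : X v - X u - (v - u) *: L = (Z (b, k) v - Z (b, k) u - (v - u) *: L)
  + ((Z (b, k) u - X u) - (Z (b, k) v - X v))); last first.
  by apply/matrixP => i j; rewrite !mxE; ring.
rewrite (le_trans (ler_normD _ _))// (le_trans (lerD hZ (ler_normB _ _)))//.
move: kQ; rewrite -/(eps k) /Q.
lra.
Qed.

End exact_solution.

(** * Rules for delta derivatives *)

Definition delta_solution_mx (R : realType) (n m : nat) (T : set R)
    (A : R -> 'M[R]_n) (X : R -> 'M[R]_(n, m)) : Prop :=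
  forall t, T t -> is_delta_derive T X t (A t *m X t).

Definition after (R : realType) (T : set R) (r : R) : set R :=
  [set t | T t /\ r <= t].

Section derivative_rules.
Variables (R : realType) (T : set R).

Lemma sigma_after (r t : R) : r <= t -> sigma (after T r) t = sigma T t.
Proof.
move=> rt; congr inf; apply/seteqP; split => s /=; first by case=> -[].
by case=> Ts ts; split => //; split => //; rewrite (le_trans rt)// ltW.
Qed.

Lemma delta_derive_after (V : normedModType R) (f : R -> V) (r t : R) (l : V) :
  r <= t -> is_delta_derive T f t l -> is_delta_derive (after T r) f t l.
Proof.
move=> rt fl e e0; rewrite sigma_after//.
have /near_within_dist[d d0 H] := fl e e0.
by apply/near_within_dist; exists d => // s [Ts _]; exact: H.
Qed.

(** Delta differentiability at [t] is local, except that at [t = r] the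
    restricted time scale has forgotten the points on the left of [r]. *)
Lemma delta_derive_from_after (V : normedModType R) (f : R -> V) (r t : R) (l : V) :
  r < t \/ (forall s, T s -> r <= s) -> r <= t ->
  is_delta_derive (after T r) f t l -> is_delta_derive T f t l.
Proof.
move=> H rt fl e e0.
have /near_within_dist[d d0 Hd] := fl e e0; rewrite sigma_after// in Hd.
apply/near_within_dist; case: H => [rt'|Tr]; last first.
  by exists d => // s Ts; apply: Hd; split => //; exact: Tr.
exists (Num.min d (t - r)); first by rewrite lt_min d0 subr_gt0.
move=> s Ts; rewrite lt_min => /andP[sd sr]; apply: Hd => //; split => //.
by move: sr; rewrite ltr_norml => /andP[]; lra.
Qed.

Hypotheses (Tcl : closed T) (Tub : unbounded_above T).

Lemma closed_after (r : R) : closed (after T r).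
Proof. exact: (closedI Tcl (@closed_ge _ r)). Qed.

Lemma unbounded_after (r : R) : unbounded_above (after T r).
Proof.
move=> x; have [t Tt] := Tub (Num.max x r); rewrite gt_max => /andP[xt rt].
by exists t => //; split => //; exact: ltW.
Qed.

Lemma delta_derive_eq (V : normedModType R) (f g : R -> V) (t : R) (l : V) :
  (forall s, T s -> f s = g s) -> is_delta_derive T f t l -> is_delta_derive T g t l.
Proof.
move=> fg fl e e0; have /near_within_dist[d d0 H] := fl e e0.
apply/near_within_dist; exists d => // s Ts sd; rewrite -!fg//; first exact: H.
exact: (sigma_in Tcl Tub).
Qed.

Lemma delta_deriveB (V : normedModType R) (f g : R -> V) (t : R) (l l' : V) :
  is_delta_derive T f t l -> is_delta_derive T g t l' ->
  is_delta_derive T (fun s => f s - g s) t (l - l').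
Proof.
move=> fl gl e e0.
have e20 : 0 < e / 2 by lra.
have /near_within_dist[d d0 H] := fl _ e20.
have /near_within_dist[d' d'0 H'] := gl _ e20.
apply/near_within_dist; exists (Num.min d d'); first by rewrite lt_min d0.
move=> s Ts; rewrite lt_min => /andP[/(H s Ts) h1 /(H' s Ts) h2].
have -> : f (sigma T t) - g (sigma T t) - (f s - g s) - (sigma T t - s) *: (l - l') =
   (f (sigma T t) - f s - (sigma T t - s) *: l) - (g (sigma T t) - g s - (sigma T t - s) *: l').
  rewrite scalerBr !opprD !opprK -!addrA; congr (_ + _).
  rewrite addrCA; congr (_ + _); rewrite [RHS]addrCA; congr (_ + _).
  exact: addrCA.
rewrite (le_trans (ler_normB _ _))//; lra.
Qed.

Lemma delta_derive_cst (V : normedModType R) (c : V) (t : R) :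
  is_delta_derive T (fun=> c) t 0.
Proof.
move=> e e0; apply/near_within_dist; exists 1 => // s _ _.
by rewrite subrr scaler0 subr0 normr0 mulr_ge0// ltW.
Qed.

Lemma delta_derive_id (t : R) : is_delta_derive T (fun s => s) t 1.
Proof.
move=> e e0; apply/near_within_dist; exists 1 => // s _ _.
by rewrite /GRing.scale/= mulr1 subrr normr0 mulr_ge0// ltW.
Qed.

Lemma delta_derive_scale (M : R) (f : R -> R) (t l : R) :
  is_delta_derive T f t l -> is_delta_derive T (fun s => M * f s) t (M * l).
Proof.
move=> fl e e0.
have e'0 : 0 < e / (`|M| + 1) by rewrite divr_gt0// ltr_wpDl.
have /near_within_dist[d d0 H] := fl _ e'0.
apply/near_within_dist; exists d => // s Ts /(H s Ts) h.
rewrite (_ : _ - _ = M * (f (sigma T t) - f s - (sigma T t - s) *: l)); last first.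
  by rewrite /GRing.scale/=; ring.
rewrite normrM (le_trans (ler_wpM2l _ h))// mulrA ler_wpM2r//.
by rewrite mulrCA ler_piMr ?(ltW e0)// ler_pdivrMr ?mul1r ?lerDl// ltr_wpDl.
Qed.

Lemma delta_derive_mulmxr (n m p : nat) (X : R -> 'M[R]_(n, m)) (C : 'M[R]_(m, p)) t l :
  is_delta_derive T X t l -> is_delta_derive T (fun s => X s *m C) t (l *m C).
Proof.
move=> Xl e e0.
have e'0 : 0 < e / (m%:R * `|C| + 1) by rewrite divr_gt0// ltr_wpDl// mulr_ge0.
have /near_within_dist[d d0 H] := Xl _ e'0.
apply/near_within_dist; exists d => // s Ts /(H s Ts) h.
rewrite scalemxAl -!mulmxBl (le_trans (norm_mulmx _ _))//.
rewrite mulrAC (le_trans (ler_wpM2l _ h)) ?mulr_ge0//.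
rewrite mulrA ler_wpM2r// mulrCA ler_piMr ?(ltW e0)// ler_pdivrMr ?mul1r ?lerDl//.
Qed.

Lemma delta_solution_mx_mulr (n m p : nat) (A : R -> 'M[R]_n)
    (X : R -> 'M[R]_(n, m)) (C : 'M[R]_(m, p)) :
  delta_solution_mx T A X -> delta_solution_mx T A (fun t => X t *m C).
Proof. by move=> HX t Tt; rewrite mulmxA; apply: delta_derive_mulmxr; exact: HX. Qed.

Lemma delta_derive_jump (V : normedModType R) (f : R -> V) t l :
  T t -> is_delta_derive T f t l -> f (sigma T t) = f t + (sigma T t - t) *: l.
Proof.
move=> Tt fl; apply/eqP; rewrite eq_sym -subr_eq0 -normr_le0.
apply/ler_addgt0Pl => e e0; rewrite addr0.
have mu0 : 0 <= sigma T t - t by rewrite subr_ge0 (sigma_ge Tub).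
have e'0 : 0 < e / (sigma T t - t + 1) by rewrite divr_gt0// ltr_wpDl.
have /near_within_dist[d d0 H] := fl _ e'0.
have := H t Tt; rewrite subrr normr0 => /(_ d0).
rewrite -normrN opprB opprB addrCA addrA (ger0_norm mu0) => /le_trans; apply.
by rewrite mulrAC ler_pdivrMr ?ltr_wpDl// ler_pM2l// lerDl.
Qed.

End derivative_rules.

(** * Transition matrices and the fundamental matrix *)

Section fundamental_matrix.
Variables (R : realType) (T : set R).
Hypotheses (Tcl : closed T) (Tub : unbounded_above T).
Variables (n : nat) (A : R -> 'M[R]_n).
Hypothesis (Ard : rd_continuous T A).
Implicit Types X Y : R -> 'M[R]_n.

(** The derivative is read off the mean value inequality: with [L] the expected
    derivative and [eta = e] near a right-dense point, and with [eta = 0] across a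
    jump, where the interval contains no point besides [t].  On the left of a
    right-scattered point only continuity is needed. *)
Lemma exact_solution_derive (r : R) X : T r ->
  (forall b, T b -> r <= b -> approx_solution T A 0 r b X /\
    exists K, forall t, T t -> r <= t -> t <= b -> `|X t| <= K) ->
  delta_solution_mx (after T r) A X.
Proof.
move=> Tr HX t [Tt rt] e e0; rewrite sigma_after//.
have [b Tb sb] := Tub (sigma T t).
have stt := sigma_ge Tub t.
have tb : t < b := le_lt_trans stt sb.
have [aX [K XK]] := HX b Tb (le_trans rt (ltW tb)).
have [M M0 AM] := rd_continuous_bounded Tcl Tub Ard b Tr.
have K0 : 0 <= K by rewrite (le_trans _ (XK t Tt rt (ltW tb))).
have nM0 : 0 <= n%:R * M by rewrite mulr_ge0.
have nAM s : T s -> r <= s -> s <= b -> n%:R * `|A s| <= n%:R * M.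
  by move=> Ts rs sb'; rewrite ler_wpM2l// AM.
have lip u v : T u -> T v -> r <= u -> u <= v -> v <= b ->
    `|X v - X u| <= (v - u) * (n%:R * M * K).
  move=> Tu Tv ru uv vb.
  by have := approx_solution_lipschitz nM0 nAM aX XK Tu Tv ru uv vb; rewrite addr0.
pose Q := n%:R * M * K.
have Q0 : 0 <= Q by rewrite mulr_ge0.
apply/near_within_dist.
move: (stt); rewrite le_eqVlt => /orP[/eqP st|ts]; last first.
  have Tst := sigma_in Tcl Tub t.
  have jump : X (sigma T t) = X t + (sigma T t - t) *: (A t *m X t).
    have := aX t _ Tt Tst rt stt (ltW sb) (A t *m X t) 0 _.
    rewrite addr0 mulr0 normr_le0 => H; apply/eqP; rewrite -subr_eq0 opprD addrA; apply: H.
    move=> w Tw tw ws; rewrite (_ : w = t) ?subrr ?normr0//.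
    by apply/eqP; rewrite eq_le tw (lt_sigma_le Tub Tw).
  pose d := Num.min (sigma T t - t) (e * (sigma T t - t) / (Q + `|A t *m X t| + 1)).
  have d0 : 0 < d.
    by rewrite lt_min subr_gt0 ts divr_gt0// ?mulr_gt0 ?subr_gt0 ?ltr_wpDl ?addr_ge0.
  exists d => // s [Ts rs]; rewrite lt_min => /andP[sd1 sd2].
  have st : s <= t.
    by apply: (lt_sigma_le Tub Ts); move: sd1; rewrite ltr_norml => /andP[]; lra.
  rewrite jump (_ : _ - _ = (X t - X s) - (t - s) *: (A t *m X t)); last first.
    by apply/matrixP => i j; rewrite !mxE; ring.
  have ts0 : 0 <= t - s by rewrite subr_ge0.
  rewrite (le_trans (ler_normB _ _))// normrZ (ger0_norm ts0).
  have l1 := lip s t Ts Tt rs st (ltW tb); rewrite -/Q in l1.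
  move: sd2; rewrite ltr_pdivlMr; last by rewrite ltr_wpDl ?addr_ge0.
  rewrite (ger0_norm ts0) (ger0_norm (x := sigma T t - s)); last by lra.
  have : e * (sigma T t - t) <= e * (sigma T t - s) by rewrite ler_wpM2l ?(ltW e0)//; lra.
  lra.
have /cvgrPdist_le Ac := Ard.1 t (sigma_right_dense Tub Tt (esym st)).
pose e' := e / 2 / (n%:R * K + 1).
have nK0 : 0 <= n%:R * K by rewrite mulr_ge0.
have e'0 : 0 < e' by rewrite !divr_gt0// ltr_wpDl.
have /near_within_dist[d d0 Hd] := Ac _ e'0.
pose e2 := e / 2 / (n%:R * M * Q + 1).
have nMQ0 : 0 <= n%:R * M * Q by rewrite mulr_ge0.
have e20 : 0 < e2 by rewrite !divr_gt0// ltr_wpDl.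
pose d1 := Num.min d (Num.min e2 (b - t)).
have d10 : 0 < d1 by rewrite !lt_min d0 e20 subr_gt0.
have near_t w : T w -> r <= w -> `|t - w| < d1 -> w <= b /\
    `|A w *m X w - A t *m X t| <= e.
  move=> Tw rw; rewrite !lt_min => /and3P[wd we wb].
  have wb' : w <= b by move: wb; rewrite ltr_norml => /andP[]; lra.
  split => //.
  rewrite (le_trans (norm_mulmx_increment nAM _ _ _ Tt rt (ltW tb)))//.
  have hA : `|A w - A t| <= e' by rewrite distrC; exact: Hd.
  have h1 : n%:R * `|A w - A t| * `|X w| <= n%:R * e' * K.
    by rewrite ler_pM// ?mulr_ge0// ?ler_wpM2l ?XK.
  have h2 : `|X w - X t| <= `|t - w| * Q.
    have [wt|tw] := leP w t.
      by rewrite distrC (ger0_norm (x := t - w)) ?subr_ge0// lip// ltW.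
    by rewrite (ler0_norm (x := t - w)) ?subr_le0 ?opprB ?lip// ltW.
  have h3 : n%:R * M * `|X w - X t| <= e2 * (n%:R * M * Q).
    rewrite (le_trans (ler_wpM2l nM0 h2))// mulrCA ler_wpM2r// ltW//.
  have h4 : n%:R * e' * K <= e / 2.
    by rewrite mulrAC mulrC /e' mulrAC ler_pdivrMr ?ltr_wpDl// ler_pM2l ?lerDl//; lra.
  have h5 : e2 * (n%:R * M * Q) <= e / 2.
    by rewrite /e2 mulrAC ler_pdivrMr ?ltr_wpDl// ler_pM2l ?lerDl//; lra.
  lra.
exists d1 => // s [Ts rs] sd; rewrite -st.
have [sb' _] := near_t s Ts rs sd.
have [s_t|ts] := leP s t.
  rewrite (ger0_norm (x := t - s)) ?subr_ge0//.
  have := aX s t Ts Tt rs s_t (ltW tb) (A t *m X t) e; rewrite addr0 mulrC; apply.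
  move=> w Tw sw wt; apply: (near_t w Tw (le_trans rs sw) _).2.
  by move: sd; rewrite !ger0_norm; lra.
rewrite (ler0_norm (x := t - s)) ?subr_le0 ?opprB ?(ltW ts)//.
rewrite -normrN opprD !opprB -scaleNr opprB.
have := aX t s Tt Ts rt (ltW ts) sb' (A t *m X t) e; rewrite addr0 mulrC; apply.
move=> w Tw tw ws; apply: (near_t w Tw (le_trans rt tw) _).2.
by move: sd; rewrite !ler0_norm; lra.
Qed.

(** Gronwall's inequality for [X - X s], with [h u = M * u]. *)
Lemma delta_solution_growth m (X : R -> 'M[R]_(n, m)) (s b M : R) : T s ->
  0 <= M -> (forall t, T t -> s <= t -> t <= b -> n%:R * `|A t| <= M) ->
  delta_solution_mx (after T s) A X ->
  forall t, T t -> s <= t -> t <= b ->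
    `|X t - X s| <= `|X s| * (expR (M * (t - s)) - 1).
Proof.
move=> Ts M0 AM HX t Tt st tb.
rewrite (mulrBr M).
apply: (gronwall (@closed_after _ _ Tcl s) (@unbounded_after _ _ Tub s)
  (z := fun u => X u - X s) (z' := fun u => A u *m X u) (s := s) (t := t) (k := `|X s|) (h := fun u => M * u) (g := fun=> M)) => //.
- by rewrite subrr.
- move=> u Tu _ _; rewrite -[A u *m _]subr0.
  by apply: delta_deriveB; [exact: HX|exact: delta_derive_cst].
- move=> u _ _ _; rewrite -[X in is_delta_derive _ _ _ X]mulr1; exact/delta_derive_scale/delta_derive_id.
move=> u [Tu su] _ ut.
rewrite (le_trans (norm_mulmx _ _))// (le_trans (ler_wpM2r _ (AM u Tu su (le_trans ut tb))))//.
by rewrite ler_wpM2l// -{1}[X u](subrK (X s)) ler_normD.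
Qed.

Lemma delta_solution_unique m (X Y : R -> 'M[R]_(n, m)) (s : R) : T s ->
  delta_solution_mx (after T s) A X -> delta_solution_mx (after T s) A Y ->
  X s = Y s -> forall t, T t -> s <= t -> X t = Y t.
Proof.
move=> Ts HX HY XY t Tt st.
have [M M0 AM] := rd_continuous_bounded Tcl Tub Ard t Ts.
have nM0 : 0 <= n%:R * M by rewrite mulr_ge0.
have := @delta_solution_growth _ (fun u => X u - Y u) s t (n%:R * M) Ts nM0.
move=> /(_ _ _ t Tt st (lexx _)).
rewrite XY subrr normr0 mul0r subr0 => H; apply/eqP.
rewrite -subr_eq0 -normr_le0; apply: H => //.
  by move=> u Tu su ut; rewrite ler_wpM2l// AM.
by move=> u Tu; rewrite mulmxBr; apply: delta_deriveB; [exact: HX|exact: HY].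
Qed.

(** [Phi s t] carries values at [s] to values at [t], for [t] after [s] only:
    nothing is said about the past of [s], where solutions need not exist without
    regressivity. *)
Lemma transition_matrix_exists : exists Phi : R -> R -> 'M[R]_n,
  forall s, T s -> Phi s s = 1%:M /\ delta_solution_mx (after T s) A (Phi s).
Proof.
suff [Phi H] : {Phi : R -> R -> 'M[R]_n & forall s, T s ->
    Phi s s = 1%:M /\ delta_solution_mx (after T s) A (Phi s)} by exists Phi.
apply: (@choice _ _ (fun s X => T s ->
    X s = 1%:M /\ delta_solution_mx (after T s) A X)) => s.
have [Ts|nTs] := pselect (T s); last by exists (fun=> 0).
have [X [Xs HX]] := exact_solution_exists Tcl Tub Ard Ts.
by exists X => _; split => //; exact: exact_solution_derive.
Qed.

Section transition_matrix.
Variable Phi : R -> R -> 'M[R]_n.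
Hypothesis HPhi : forall s, T s ->
  Phi s s = 1%:M /\ delta_solution_mx (after T s) A (Phi s).

Lemma transition_matrix_cocycle r s t : T r -> T s -> T t -> r <= s -> s <= t ->
  Phi r t = Phi s t *m Phi r s.
Proof.
move=> Tr Ts Tt rs st.
apply: (delta_solution_unique (X := Phi r) (Y := fun t => Phi s t *m Phi r s) Ts) => //.
- move=> u [Tu su].
  have ru := le_trans rs su.
  have := (HPhi Tr).2 u (conj Tu ru).
  move=> /(delta_derive_after su); rewrite (_ : after (after T r) s = after T s)//.
  apply/seteqP; split => v /=; first by case=> -[Tv rv] sv.
  by case=> Tv sv; split => //; split => //; exact: le_trans sv.
- exact: delta_solution_mx_mulr (HPhi Ts).2.
by rewrite (HPhi Ts).1 mul1mx.
Qed.

(** Over a short step the transition matrix is close to the identity, and across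
    a jump it is [1%:M + graininess T t *: A t], invertible by regressivity; the
    cocycle identity multiplies these factors together. *)
Lemma transition_matrix_unit r b : T r -> T b -> r <= b -> regressive T A ->
  Phi r b \in unitmx.
Proof.
move=> Tr Tb rb Areg.
have [M M0 AM] := rd_continuous_bounded Tcl Tub Ard b Tr.
have nM0 : 0 <= n%:R * M by rewrite mulr_ge0.
have [d d0 Hd] := expR_small n%:R (n%:R * M) ltr01.
have short s t : T s -> T t -> r <= s -> s <= t -> t <= b -> t - s < d ->
    Phi s t \in unitmx.
  move=> Ts Tt rs st tb td.
  have := @delta_solution_growth _ (Phi s) s b (n%:R * M) Ts nM0 _ (HPhi Ts).2 t Tt st tb.
  rewrite (HPhi Ts).1 => H.
  rewrite (_ : Phi s t = 1%:M - (1%:M - Phi s t)); last by rewrite opprB addrCA subrr addr0.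
  apply: unitmx_near1.
  have st0 : 0 <= t - s by rewrite subr_ge0.
  apply: le_lt_trans (Hd (t - s) _); last by rewrite ger0_norm.
  rewrite ler_wpM2l//.
  rewrite distrC (le_trans (H _))//.
    by move=> u Tu su ub; rewrite ler_wpM2l// AM// (le_trans rs).
  rewrite ler_piMl ?norm_mx1_le1//.
  by rewrite subr_ge0 -[leLHS]expR0 ler_expR mulr_ge0.
apply: (time_scale_induction Tcl (r := r) (b := b) (P := fun t => Phi r t \in unitmx)) => //.
- by rewrite (HPhi Tr).1 unitmx1.
- move=> t Tt rt tb Pt; have [s Ts [ts H]] := right_dense_step Tcl Tub Tt d0.
  exists s => //; split => // u Tu tu us ub.
  rewrite (transition_matrix_cocycle Tr Tt Tu rt (ltW tu)) unitmx_mul Pt andbT.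
  have [ut|[_ ud]] := H u Tu tu us; last by apply: short => //; exact: ltW.
  have Ttt : after T t t by split.
  have := delta_derive_jump (@unbounded_after _ _ Tub t) Ttt ((HPhi Tt).2 t Ttt).
  rewrite sigma_after// (HPhi Tt).1 mulmx1 -ut => ->.
  by rewrite ut; exact: Areg.
move=> t Tt rt tb llt Pt.
have [s Ts /andP[s1 s2]] := llt (Num.min d (t - r)) ltac:(by rewrite lt_min d0 subr_gt0).
have m1 : Num.min d (t - r) <= d by rewrite ge_min lexx.
have m2 : Num.min d (t - r) <= t - r by rewrite ge_min lexx orbT.
have rs : r <= s by lra.
rewrite (transition_matrix_cocycle Tr Ts Tt rs (ltW s2)) unitmx_mul Pt// andbT.
by apply: short => //; lra.
Qed.

End transition_matrix.

(** Before [t0] the solution is the inverse of the transition matrix to [t0].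
    Near any [t] it coincides with [Phi r] times a constant matrix, for an [r] that
    follows neither [t] nor [t0], and there it inherits the derivative of
    [Phi r]. *)
Theorem fundamental_matrix_exists (t0 : R) : T t0 -> regressive T A ->
  exists2 X, X t0 = 1%:M & delta_solution_mx T A X.
Proof.
move=> Tt0 Areg; have [Phi HPhi] := transition_matrix_exists.
pose X t := if t0 <= t then Phi t0 t else invmx (Phi t t0).
have XPhi r t : T r -> T t -> r <= t0 -> r <= t -> X t = Phi r t *m invmx (Phi r t0).
  move=> Tr Tt rt0 rt; rewrite /X; have [t0t|tt0] := leP t0 t.
    rewrite (transition_matrix_cocycle HPhi Tr Tt0 Tt rt0 t0t) mulmxK//.
    exact: transition_matrix_unit.
  have U := transition_matrix_unit HPhi Tt Tt0 (ltW tt0) Areg.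
  rewrite -[RHS](mulKmx U) [Phi t t0 *m (_ *m _)]mulmxA.
  rewrite -(transition_matrix_cocycle HPhi Tr Tt Tt0 rt (ltW tt0)) mulmxV ?mulmx1//.
  exact: transition_matrix_unit.
exists X; first by rewrite /X lexx (HPhi _ Tt0).1.
move=> t Tt.
(* when no point of T precedes both t and t0, one of them is the minimum of T
   and [r] is that minimum *)
have [r [Tr rt0 rt H]] : exists r, [/\ T r, r <= t0, r <= t &
    r < t \/ (forall s, T s -> r <= s)].
  have [[r Tr]|H] := pselect (exists2 r, T r & r < Num.min t t0).
    by rewrite lt_min => /andP[rt rt0]; exists r; split; rewrite ?(ltW rt) ?(ltW rt0)//; left.
  exists (Num.min t t0); split; rewrite ?ge_min ?lexx ?orbT//; first by case: leP.
  by right => s Ts; rewrite leNgt; apply/negP => st; apply: H; exists s.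
apply: (delta_derive_from_after H rt).
have Tcl' := @closed_after _ _ Tcl r; have Tub' := @unbounded_after _ _ Tub r.
apply: (delta_derive_eq Tcl' Tub' (f := fun t => Phi r t *m invmx (Phi r t0))).
  by move=> s [Ts rs]; rewrite (XPhi r).
rewrite (XPhi r)//.
by have := delta_solution_mx_mulr (invmx (Phi r t0)) (HPhi _ Tr).2 (conj Tt rt).
Qed.

End fundamental_matrix.

(** * Convergence at infinity *)

Lemma unbounded_above_ereal_sup (R : realType) (T : set R) :
  ereal_sup (EFin @` T) = +oo%E -> unbounded_above T.
Proof.
move=> hT x; apply/not_exists2P => H.
have : (ereal_sup (EFin @` T) <= x%:E)%E.
  apply: ge_ereal_sup => _ [t Tt <-]; rewrite lee_fin leNgt; apply/negP.
  by case: (H t).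
by rewrite hT leye_eq.
Qed.

Lemma cvg_mulmxr (R : realType) (I : Type) (E : set_system I) {FE : Filter E}
    (n m p : nat) (f : I -> 'M[R]_(n, m)) (l : 'M[R]_(n, m))
    (C : 'M[R]_(m, p)) :
  f @ E --> l -> (fun t => f t *m C) @ E --> l *m C.
Proof.
move=> fl; apply/cvgrPdist_le => e e0.
have Q0 : 0 <= m%:R * `|C| by rewrite mulr_ge0.
have e'0 : 0 < e / (m%:R * `|C| + 1) by rewrite divr_gt0// ltr_wpDl.
have /cvgrPdist_le/(_ _ e'0) := fl; apply: filterS => t h.
rewrite -mulmxBl (le_trans (norm_mulmx _ _))//.
rewrite mulrAC (le_trans (ler_wpM2l Q0 h))//.
by rewrite mulrCA ler_piMr ?(ltW e0)// ler_pdivrMr ?ltr_wpDl// mul1r lerDl.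
Qed.

(** The computation behind the derivative of [y = (1%:M - B)^-1 *m x], with
    [B = l - F], at the points [s], [t] and [sigma T t]: it
    expresses [1%:M - B (sigma T t)] times the defect of [y] as the defect of [x], the
    defect of [F] applied to [y s], and a term that vanishes as [s] tends to [t]. *)
Lemma transformed_increment (R : realType) (n m : nat) (A0 l Fs Ft Fst : 'M[R]_n)
    (xst ys yt : 'M[R]_(n, m)) (r : R) :
  xst - (1%:M - (l - Fst)) *m ys + r *: (A0 *m (l - Ft) *m yt) =
  (xst - (1%:M - (l - Fs)) *m ys - r *: (A0 *m ((1%:M - (l - Ft)) *m yt)))
    - (Fst - Fs - r *: A0) *m ys - r *: (A0 *m (ys - yt)).
Proof.
rewrite !(mulmxBr, mulmxBl, mul1mx, mulmx1, mulmxA) -!scalemxAl.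
move: (l *m ys) (Fst *m ys) (Fs *m ys) (A0 *m ys) (A0 *m yt) (A0 *m l *m yt) (A0 *m Ft *m yt).
by move=> *; apply/matrixP => i j; rewrite !mxE; ring.
Qed.

Section convergence_at_infinity.
Variables (R : realType) (T : set R).
Hypotheses (Tcl : closed T) (Tub : unbounded_above T).

Lemma near_infty_in (P : R -> Prop) :
  (\forall t \near infty_in T, P t) <-> exists M : R, forall t, T t -> M < t -> P t.
Proof.
rewrite /infty_in near_withinE; split.
  by move=> [M [_ H]]; exists M => t Tt Mt; exact: H.
by move=> [M H]; exists M; split; [exact: num_real|move=> t Mt Tt; exact: H].
Qed.

#[local] Instance infty_in_filter : ProperFilter (infty_in T).
Proof.
apply: Build_ProperFilter_ex => P /near_infty_in[M H].
by have [t Tt Mt] := Tub M; exists t; exact: H.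
Qed.

Lemma antiderivative_unique (V : normedModType R) (f F G : R -> V) a b :
  delta_antiderivative T f F -> delta_antiderivative T f G ->
  T a -> T b -> a <= b -> F b - F a = G b - G a.
Proof.
move=> HF HG Ta Tb ab; apply/eqP; rewrite -subr_eq0 -normr_le0.
rewrite (_ : _ - _ - _ = (F b - G b) - (F a - G a)); last first.
  by rewrite !opprD !opprK addrACA.
have := gronwall Tcl Tub (z := fun t => (F t - G t) - (F a - G a)) (z' := fun=> 0)
  (h := fun=> 0) (g := fun=> 0) (k := 0) (s := a) (t := b).
rewrite mul0r; apply => //.
- by rewrite subrr.
- move=> u Tu _ _; rewrite -[0](subr0) -{1}(subrr (f u)).
  apply: delta_deriveB; last exact: delta_derive_cst.
  by apply: delta_deriveB; [exact: HF|exact: HG].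
- by move=> u _ _ _; exact: delta_derive_cst.
by move=> u _ _ _; rewrite normr0 mul0r.
Qed.

Lemma delta_integralE (V : normedModType R) (f F : R -> V) a b :
  delta_antiderivative T f F -> T a -> T b -> a <= b ->
  delta_integral T f a b = F b - F a.
Proof.
move=> HF Ta Tb ab; apply: xget_unique; first by exists F.
by move=> _ [G HG ->]; exact: (antiderivative_unique HG HF).
Qed.

Lemma antiderivative_cvg (V : normedModType R) (f F : R -> V) a :
  delta_antiderivative T f F -> T a ->
  cvg (delta_integral T f a b @[b --> infty_in T]) -> cvg (F @ infty_in T).
Proof.
move=> HF Ta /cvg_ex[/= l Hl]; apply/cvg_ex; exists (l + F a).
apply: (@cvg_trans _ ((fun b => delta_integral T f a b + F a) @ infty_in T)); last first.
  by apply: cvgD => //; exact: cvg_cst.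
apply: near_eq_cvg; apply/near_infty_in; exists a => b Tb ab.
by rewrite (delta_integralE HF Ta Tb (ltW ab)) subrK.
Qed.

Lemma delta_integral_ooE (V : normedModType R) (f F : R -> V) l t :
  delta_antiderivative T f F -> F @ infty_in T --> l -> T t ->
  delta_integral_oo T f t = l - F t.
Proof.
move=> HF Fl Tt; apply: cvg_lim; first exact: norm_hausdorff.
apply: (@cvg_trans _ ((fun b => F b - F t) @ infty_in T)); last first.
  by apply: cvgB => //; exact: cvg_cst.
apply: near_eq_cvg; apply/near_infty_in; exists t => b Tb tb.
by rewrite (delta_integralE HF Tt Tb (ltW tb)).
Qed.

Section tail_of_coefficient.
Variables (n : nat) (A F : R -> 'M[R]_n) (l : 'M[R]_n).
Hypotheses (HF : delta_antiderivative T A F) (Fl : F @ infty_in T --> l).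
Let B t := l - F t.

(** Absolute convergence of the integral of [A *m B] enters through an integrable
    majorant [g] with a convergent antiderivative [G]. *)
Variables (g G : R -> R) (Goo K t0 : R).
Hypotheses (HG : delta_antiderivative T g G) (GG : G @ infty_in T --> Goo).
Hypotheses (K0 : 0 <= K) (g0 : forall t, T t -> 0 <= g t).
Hypothesis (ABg : forall t, T t -> `|A t *m B t| <= K * g t).
Hypothesis (Bsmall : forall t, T t -> t0 <= t -> n%:R * `|B t| <= 2^-1).

Let U t : T t -> t0 <= t -> 1%:M - B t \in unitmx.
Proof. by move=> Tt tt0; apply: unitmx_near1; have := Bsmall Tt tt0; lra. Qed.

Lemma growth_exponent_small (e : R) : 0 < e ->
  exists2 s0 : R, t0 <= s0 & forall s t, T s -> T t -> s0 < s -> s <= t ->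
    expR (2 * n%:R * K * (G t - G s)) - 1 <= e.
Proof.
move=> e0; have [d d0 H] := @expR_small R 1 (2 * n%:R * K) e e0.
have d20 : 0 < d / 3 by lra.
have /cvgrPdist_le/(_ _ d20)/near_infty_in[M HM] := GG.
exists (Num.max t0 M); first by rewrite le_max lexx.
move=> s t Ts Tt; rewrite gt_max => /andP[st0 Ms] st.
rewrite ltW// -[ltLHS]mul1r; apply: H.
have h1 := HM s Ts Ms; have h2 := HM t Tt (lt_le_trans Ms st).
have := ler_distD Goo (G t) (G s); rewrite (distrC (G t) Goo); lra.
Qed.

Section solution.
Variables (m : nat) (x : R -> 'M[R]_(n, m)).
Hypothesis Hx : delta_solution_mx T A x.
(** The change of unknown that removes the conditionally convergent part of the
    system: [B] has derivative [- A]. *)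
Let y t := invmx (1%:M - B t) *m x t.

Let xy t : T t -> t0 <= t -> x t = (1%:M - B t) *m y t.
Proof. by move=> Tt tt0; rewrite /y mulKVmx// U. Qed.

Lemma transformed_solution_continuous t : T t -> t0 <= t ->
  y @ within (after T t0) (nbhs t) --> y t.
Proof.
move=> Tt tt0.
have cx : x @ within T (nbhs t) --> x t.
  exact: (delta_derive_continuous Tub Tt (Hx Tt)).
have cF : F @ within T (nbhs t) --> F t.
  exact: (delta_derive_continuous Tub Tt (HF Tt)).
apply/cvgrPdist_le => e e0; apply/near_within_dist.
have nY : 0 <= n%:R * `|y t| by rewrite mulr_ge0.
have e4 : 0 < e / 4 by lra.
have e4n : 0 < e / 4 / (n%:R * `|y t| + 1) by rewrite divr_gt0// ltr_wpDl.
have /cvgrPdist_le/(_ _ e4)/near_within_dist[d1 d10 H1] := cx.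
have /cvgrPdist_le/(_ _ e4n)/near_within_dist[d2 d20 H2] := cF.
exists (Num.min d1 d2); first by rewrite lt_min d10.
move=> s [Ts st0]; rewrite lt_min => /andP[/(H1 s Ts) h1 /(H2 s Ts) h2].
rewrite distrC (le_trans (norm_le_sub_mulmx _ (Bsmall Ts st0)))//.
rewrite mulmxBr -xy// (_ : x s - _ = (x s - x t) - (F s - F t) *m y t); last first.
  rewrite {1}(xy Tt tt0) /B !(mulmxBl, mul1mx) /=.
  by apply/matrixP => i j; rewrite !mxE; ring.
have h3 : `|(F s - F t) *m y t| <= e / 4.
  rewrite (le_trans (norm_mulmx _ _))// mulrAC.
  rewrite (le_trans (ler_wpM2l nY (y := e / 4 / (n%:R * `|y t| + 1)) _))// 1?distrC//.
  by rewrite mulrCA ler_piMr ?(ltW e4)// ler_pdivrMr ?ltr_wpDl// mul1r lerDl.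
rewrite distrC in h1.
have := ler_normB (x s - x t) ((F s - F t) *m y t); lra.
Qed.

(** From [x = (1%:M - B) *m y], the product rule gives
    [A *m x = A *m y + (1%:M - B (sigma T t)) *m y'], and
    [A *m x - A *m y] is [- A *m B *m y].  The rule is proved here on increments,
    so that the inverse matrix is never differentiated. *)
Lemma transformed_solution_derive t : T t -> t0 <= t ->
  is_delta_derive (after T t0) y t
    (- (invmx (1%:M - B (sigma T t)) *m (A t *m B t *m y t))).
Proof.
move=> Tt tt0 e e0; rewrite sigma_after//.
set st := sigma T t.
have tst : t0 <= st := le_trans tt0 (sigma_ge Tub t).
have Tst : T st := sigma_in Tcl Tub t.
have Y0 : 0 <= `|y t| + 1 by rewrite addr_ge0.
pose e1 := e / 6.
have e10 : 0 < e1 by rewrite divr_gt0.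
pose e2 := e / 6 / (n%:R * (`|y t| + 1) + 1).
have q2 : 0 <= n%:R * (`|y t| + 1) by rewrite mulr_ge0.
have e20 : 0 < e2 by rewrite !divr_gt0// ltr_wpDl.
pose e3 := Num.min 1 (e / 6 / (n%:R * `|A t| + 1)).
have q3 : 0 <= n%:R * `|A t| by rewrite mulr_ge0.
have e30 : 0 < e3 by rewrite lt_min ltr01 !divr_gt0// ltr_wpDl.
have /near_within_dist[d1 d10 H1] := Hx Tt e10.
have /near_within_dist[d2 d20 H2] := HF Tt e20.
have /cvgrPdist_le/(_ _ e30)/near_within_dist[d3 d30 H3] :=
  transformed_solution_continuous Tt tt0.
apply/near_within_dist; exists (Num.min d1 (Num.min d2 d3)).
  by rewrite !lt_min d10 d20.
move=> s [Ts st0]; rewrite !lt_min => /and3P[/(H1 s Ts) h1 /(H2 s Ts) h2 sd3].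
have {H3 sd3}h3 := H3 s (conj Ts st0) sd3; rewrite distrC in h3.
rewrite -/st in h1 h2; set r := st - s in h1 h2 *.
have [h3a h3b] : `|y s - y t| <= 1 /\ `|y s - y t| <= e / 6 / (n%:R * `|A t| + 1).
  by move: h3; rewrite le_min => /andP[].
rewrite (le_trans (norm_le_sub_mulmx _ (Bsmall Tst tst)))//.
have -> : (1%:M - B st) *m (y st - y s - r *: - (invmx (1%:M - B st) *m (A t *m B t *m y t)))
  = (x st - x s - r *: (A t *m x t)) - (F st - F s - r *: A t) *m y s
    - r *: (A t *m (y s - y t)).
  rewrite scalerN opprK mulmxDr -scalemxAr mulKVmx ?U// mulmxBr -xy//.
  rewrite (xy Ts st0) (xy Tt tt0).
  exact: transformed_increment.
have ys : `|y s| <= `|y t| + 1.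
  by rewrite -[y s](subrK (y t)) addrC (le_trans (ler_normD _ _))// lerD2l.
have r0 : 0 <= `|r| by [].
have g2 : `|(F st - F s - r *: A t) *m y s| <= e / 6 * `|r|.
  rewrite (le_trans (norm_mulmx _ _))//.
  have : n%:R * `|F st - F s - r *: A t| * `|y s| <= n%:R * (e2 * `|r|) * (`|y t| + 1).
    by rewrite ler_pM ?mulr_ge0// ler_wpM2l.
  move=> /le_trans; apply.
  rewrite (_ : _ * _ = e2 * (n%:R * (`|y t| + 1)) * `|r|); last by ring.
  by rewrite ler_wpM2r// /e2 mulrAC ler_pdivrMr ?ltr_wpDl// ler_pM2l ?divr_gt0// lerDl.
have g3 : `|r *: (A t *m (y s - y t))| <= e / 6 * `|r|.
  rewrite normrZ mulrC ler_wpM2r// (le_trans (norm_mulmx _ _))//.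
  rewrite (le_trans (ler_wpM2l q3 h3b))//.
  by rewrite mulrCA ler_piMr ?divr_ge0 ?(ltW e0)// ler_pdivrMr ?ltr_wpDl// mul1r lerDl.
have g4 := ler_normB (x st - x s - r *: (A t *m x t) - (F st - F s - r *: A t) *m y s)
  (r *: (A t *m (y s - y t))).
have g5 := ler_normB (x st - x s - r *: (A t *m x t)) ((F st - F s - r *: A t) *m y s).
rewrite /e1 in h1; lra.
Qed.

Lemma transformed_solution_growth s t : T s -> T t -> t0 <= s -> s <= t ->
  `|y t - y s| <= `|y s| * (expR (2 * n%:R * K * (G t - G s)) - 1).
Proof.
move=> Ts Tt st0 st; rewrite (mulrBr (2 * n%:R * K)).
have Tst0 : after T t0 s by [].
have Ttt0 : after T t0 t by split => //; exact: le_trans st.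
have nK0 : 0 <= 2 * n%:R * K by rewrite !mulr_ge0.
apply: (gronwall (@closed_after _ _ Tcl t0) (@unbounded_after _ _ Tub t0)
  (z := fun u => y u - y s)
  (z' := fun t => - (invmx (1%:M - B (sigma T t)) *m (A t *m B t *m y t)))
  (h := fun u => 2 * n%:R * K * G u) (g := fun u => 2 * n%:R * K * g u)
  (k := `|y s|) (s := s) (t := t)) => //.
- by rewrite subrr.
- move=> u [Tu ut0] _ _; rewrite -[X in is_delta_derive _ _ _ X]subr0.
  by apply: delta_deriveB; [exact: (transformed_solution_derive Tu ut0)|exact: delta_derive_cst].
- move=> u [Tu ut0] _ _; apply: delta_derive_after => //.
  exact/delta_derive_scale/HG.
- by move=> u [Tu ut0] _ _; rewrite mulr_ge0// g0.
move=> u [Tu ut0] _ _.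
have Tsu := sigma_in Tcl Tub u.
have su0 := le_trans ut0 (sigma_ge Tub u).
rewrite normrN (le_trans (norm_le_sub_mulmx _ (Bsmall Tsu su0)))//.
rewrite mulKVmx ?U//.
have h1 : `|A u *m B u *m y u| <= n%:R * (K * g u) * (`|y u - y s| + `|y s|).
  rewrite (le_trans (norm_mulmx _ _))// ler_pM ?mulr_ge0 ?ler_wpM2l ?ABg//.
  by rewrite -{1}[y u](subrK (y s)) ler_normD.
lra.
Qed.

Lemma transformed_solution_growth_le (e s t : R) :
  expR (2 * n%:R * K * (G t - G s)) - 1 <= e ->
  T s -> T t -> t0 <= s -> s <= t -> `|y t - y s| <= e * `|y s|.
Proof.
move=> eG Ts Tt st0 st; rewrite (le_trans (transformed_solution_growth Ts Tt st0 st))//.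
by rewrite mulrC ler_wpM2r.
Qed.

(** Late increments of [y] are small relative to [y], first by the factor 1, which
    bounds [y], then by any factor, which makes [y] Cauchy. *)
Lemma transformed_solution_cvg : cvg (y @ infty_in T).
Proof.
have [s1 s1t0 H1] := growth_exponent_small ltr01.
have [s Ts s1s] := Tub s1.
have st0 : t0 <= s by rewrite (le_trans s1t0)// ltW.
have yb t : T t -> s <= t -> `|y t| <= 2 * `|y s|.
  move=> Tt st.
  have := transformed_solution_growth_le (H1 s t Ts Tt s1s st) Ts Tt st0 st.
  rewrite mul1r.
  have := ler_normD (y t - y s) (y s); rewrite subrK; lra.
apply: cauchy_cvg; apply: cauchy_exP => e e0.
have ys0 : 0 < 2 * `|y s| + 1 by rewrite ltr_wpDl// mulr_ge0.
have [s2 s2t0 H2] := @growth_exponent_small (e / 2 / (2 * `|y s| + 1)) ltac:(by rewrite !divr_gt0).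
have [u Tu] := Tub (Num.max s s2); rewrite gt_max => /andP[su s2u].
exists (y u); apply/near_infty_in; exists u => t Tt ut.
rewrite -ball_normE /ball_ /= distrC.
have ut0 : t0 <= u by rewrite (le_trans s2t0)// ltW.
apply: (le_lt_trans (transformed_solution_growth_le (H2 u t Tu Tt s2u (ltW ut)) Tu Tt ut0 (ltW ut))).
have q0 : 0 < e / 2 / (2 * `|y s| + 1) by rewrite !divr_gt0.
apply: (le_lt_trans (ler_wpM2l (ltW q0) (yb u Tu (ltW su)))).
rewrite mulrAC ltr_pdivrMr//.
have : e / 2 * (2 * `|y s| + 1) < e * (2 * `|y s| + 1) by rewrite ltr_pM2r//; lra.
apply: le_lt_trans; rewrite ler_wpM2l ?lerDl// ltW//; lra.
Qed.

Lemma solution_cvg (yoo : 'M[R]_(n, m)) : y @ infty_in T --> yoo ->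
  x @ infty_in T --> yoo.
Proof.
move=> yl; apply/cvgrPdist_le => e e0.
have Q0 : 0 <= n%:R * (`|yoo| + 1) by rewrite mulr_ge0// addr_ge0.
have e'0 : 0 < e / 2 / (n%:R * (`|yoo| + 1) + 1) by rewrite !divr_gt0// ltr_wpDl.
have e20 : 0 < Num.min 1 (e / 2) by rewrite lt_min ltr01 divr_gt0.
have /cvgrPdist_le/(_ _ e'0)/near_infty_in[M1 H1] := Fl.
have /cvgrPdist_le/(_ _ e20)/near_infty_in[M2 H2] := yl.
apply/near_infty_in; exists (Num.max t0 (Num.max M1 M2)) => t Tt.
rewrite !gt_max => /and3P[tt0 /(H1 t Tt) h1 /(H2 t Tt)].
rewrite le_min => /andP[h2 h3].
have yt : `|y t| <= `|yoo| + 1.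
  by rewrite -[y t](subrK yoo) addrC (le_trans (ler_normD _ _))// lerD2l distrC.
rewrite (xy Tt (ltW tt0)) mulmxBl mul1mx opprB addrCA addrC.
rewrite (le_trans (ler_normD _ _))//.
have : `|B t *m y t| <= e / 2.
  rewrite (le_trans (norm_mulmx _ _))//.
  have : n%:R * `|B t| * `|y t| <= n%:R * (e / 2 / (n%:R * (`|yoo| + 1) + 1)) * (`|yoo| + 1).
    by rewrite ler_pM ?mulr_ge0// ler_wpM2l.
  move=> /le_trans; apply; rewrite mulrAC mulrC mulrAC.
  by rewrite ler_pdivrMr ?ltr_wpDl// ler_pM2l ?divr_gt0// lerDl.
lra.
Qed.

End solution.

Lemma delta_solution_cvg m (x : R -> 'M[R]_(n, m)) :
  delta_solution_mx T A x -> cvg (x @ infty_in T).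
Proof.
move=> Hx; have /cvg_ex[/= yoo yl] := transformed_solution_cvg Hx.
by apply/cvg_ex; exists yoo; exact: solution_cvg.
Qed.

(** The matrix solution normalised by [Y s = 1%:M] has an invertible limit [Yoo]
    if [s] is late enough, since [Y] then stays close to [1%:M]; multiplying on the
    right by [invmx Yoo *m xoo] reaches [xoo]. *)
Lemma delta_solution_prescribed_limit m (xoo : 'M[R]_(n, m)) :
  rd_continuous T A -> regressive T A ->
  exists2 x, delta_solution_mx T A x & x @ infty_in T --> xoo.
Proof.
move=> Ard Areg.
have [s0 s0t0 H] := @growth_exponent_small (2 * (n%:R + 1))^-1 ltac:(by rewrite invr_gt0 mulr_gt0// ltr_wpDl).
have [s Ts s0s] := Tub s0.
have ts : t0 <= s by rewrite (le_trans s0t0)// ltW.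
have [X0 X0s HX0] := fundamental_matrix_exists Tcl Tub Ard Ts Areg.
pose X t := X0 t *m (1%:M - B s).
have HX : delta_solution_mx T A X by exact: delta_solution_mx_mulr.
pose Y t := invmx (1%:M - B t) *m X t.
have Ys : Y s = 1%:M by rewrite /Y /X X0s mul1mx mulVmx// U.
have /cvg_ex[/= Yoo Yl] := transformed_solution_cvg HX.
have Yn : `|1%:M - Yoo| <= (2 * (n%:R + 1))^-1.
  have c : `|1%:M - Y t| @[t --> infty_in T] --> `|1%:M - Yoo|.
    by apply: cvg_norm; apply: cvgB => //; exact: cvg_cst.
  rewrite -(cvg_lim (@Rhausdorff R) c); apply: limr_le.
    by apply/cvg_ex; eexists; exact: c.
  apply/near_infty_in; exists s => t Tt st.
  have := transformed_solution_growth_le HX (H s t Ts Tt s0s (ltW st)) Ts Tt ts (ltW st).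
  rewrite -/(Y s) -/(Y t) Ys distrC.
  by move=> /le_trans; apply; rewrite ler_piMr ?norm_mx1_le1// invr_ge0 mulr_ge0// addr_ge0.
have Yu : Yoo \in unitmx.
  rewrite (_ : Yoo = 1%:M - (1%:M - Yoo)); last by rewrite opprB addrCA subrr addr0.
  apply: unitmx_near1; rewrite (le_lt_trans (ler_wpM2l _ Yn))//.
  rewrite ltr_pdivrMr ?mulr_gt0 ?ltr_wpDl//.
  have : 0 <= n%:R :> R by []. 
  lra.
exists (fun t => X t *m (invmx Yoo *m xoo)); first exact: delta_solution_mx_mulr.
rewrite -[xoo in X in _ --> X](mulKVmx Yu).
by apply: cvg_mulmxr; exact: (solution_cvg Yl).
Qed.

End tail_of_coefficient.
End convergence_at_infinity.

Theorem theorem2 (R : realType) (n : nat) (T : set R) (a : R)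
    (A : R -> 'M[R]_n) (N : 'M[R]_n -> R)
    (hT : time_scale T) (hsup : ereal_sup (EFin @` T) = +oo%E)
    (ha : T a) (ha0 : 0 < a) (hN : matrix_norm N)
    (hrd : rd_continuous T A) (hreg : regressive T A)
    (hint : delta_integral_oo_cvg T A a)
    (habs : delta_integral_oo_abs_cvg N T
              (fun t => A t *m delta_integral_oo T A t) a) :
  class_S T A.
Proof.
have Tcl := hT.2; have Tub := unbounded_above_ereal_sup hsup.
have [[F HF] Fc] := hint; have [[G HG] Gc] := habs.
have /cvg_ex[/= l Fl] := antiderivative_cvg Tcl Tub HF ha Fc.
have /cvg_ex[/= Goo GG] := antiderivative_cvg Tcl Tub HG ha Gc.
have [c c0 Nc] := matrix_norm_dominates hN.
have BE t : T t -> delta_integral_oo T A t = l - F t.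
  by move=> Tt; exact: (delta_integral_ooE Tcl Tub HF Fl Tt).
have AB t : T t -> `|A t *m (l - F t)| <= c * N (A t *m delta_integral_oo T A t).
  by move=> Tt; rewrite BE.
have e0 : 0 < 2^-1 / (n%:R + 1) :> R by rewrite divr_gt0// ltr_wpDl.
have FF := infty_in_filter Tub.
have /cvgrPdist_le/(_ _ e0)/near_infty_in[M HM] := Fl.
have [t0 _ Mt0] := Tub M.
have Bsmall t : T t -> t0 <= t -> n%:R * `|l - F t| <= 2^-1.
  move=> Tt t0t; rewrite (le_trans (ler_wpM2l _ (HM t Tt (lt_le_trans Mt0 t0t))))//.
  by rewrite mulrCA ler_piMr// ler_pdivrMr ?ltr_wpDl// mul1r lerDl.
have N0 t : T t -> 0 <= N (A t *m delta_integral_oo T A t) by case: hN.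
split.
  by move=> x Hx; exact: (delta_solution_cvg Tcl Tub HF Fl HG GG c0 N0 AB Bsmall Hx).
move=> xoo.
exact: (delta_solution_prescribed_limit Tcl Tub HF Fl HG GG c0 N0 AB Bsmall xoo hrd hreg).
Qed.
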